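(* Let $H$ be a semisimple Hopf algebra over an algebraically closed field $K$ of characteristic zero, let $V$ be a finite-dimensional $H$-module with character $\chi$, let $\eta$ be the character of the induced $D(H)$-module $D(H)\otimes_H V$, and let $u\in D(H)$ be the Drinfel'd element. Then for every natural number $m$, $$\nu_m(\chi)=\frac{1}{\dim(H)}\,\eta(u^m).$$
   Context: A semisimple Hopf algebra is finite-dimensional, and contains a unique two-sided integral $\Lambda$ with $\varepsilon(\Lambda)=1$, where $\varepsilon$ is the counit; its antipode $S$ satisfies $S^2=\mathrm{id}$ in characteristic zero. The $m$-th Frobenius-Schur indicator of a character $\chi$ is $\nu_m(\chi):=\chi(\Lambda^{[m]})$, where $\Lambda^{[m]}:=\Lambda_{(1)}\Lambda_{(2)}\cdots\Lambda_{(m)}$ (Sweedler notation for the iterated coproduct). The Drinfel'd double $D(H)$ is the Hopf algebra with underlying vector space $H^*\otimes H$, with the tensor product coalgebra structure of $H^{*\,\mathrm{cop}}\otimes H$ and with product $(\varphi\otimes h)(\varphi'\otimes h')=\varphi'_{(1)}(S^{-1}(h_{(3)}))\,\varphi'_{(3)}(h_{(1)})\;\varphi\varphi'_{(2)}\otimes h_{(2)}h'$. $H$ is regarded as a subalgebra of $D(H)$ via $h\mapsto\varepsilon\otimes h$. If $b_1,\ldots,b_n$ is a basis of $H$ with dual basis $b_1^*,\ldots,b_n^*$ of $H^*$, the Drinfel'd element is $u=\sum_{i=1}^n S^{-1}(b_i^* )\otimes b_i$, where the antipode of $H^*$, also denoted $S$, is the transpose of that of $H$. Modules are left modules. *)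

(* Defs.v *)
From HB Require Import structures.
From mathcomp Require Import all_boot all_order all_algebra all_field.

Set Implicit Arguments.
Unset Strict Implicit.
Unset Printing Implicit Defensive.

Import GRing.Theory passmx.
Local Open Scope ring_scope.

(* Tensor products of finite-dimensional spaces.  An element of U (x) V is    *)
(* the matrix of its coordinates in the basis (u_i (x) v_j), where (u_i) and  *)
(* (v_j) are the library bases of U and V.  Only tens and tlift (with         *)
(* tlift_tens, the universal property) are meant to be used.                  *)

Section Tensor.
Variable K : fieldType.

Definition tensor (U V : vectType K) : vectType K :=
  'M[K]_(\dim {:U}, \dim {:V}).

Definition tens (U V : vectType K) (u : U) (v : V) : tensor U V :=
  \matrix_(i, j) (coord (vbasis {:U}) i u * coord (vbasis {:V}) j v).

(* The linear extension of u (x) v |-> f u v, for f bilinear.  Applied to a   *)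
(* coproduct, tlift (fun a b => f a b) (comul h) is Sweedler's                *)
(* f (h_(1)) (h_(2)).                                                         *)
Definition tlift (U V W : vectType K) (f : U -> V -> W) (t : tensor U V) : W :=
  \sum_i \sum_j (t : 'M_(_, _)) i j *: f (vbasis {:U})`_i (vbasis {:V})`_j.

Lemma tlift_is_linear (U V W : vectType K) (f : U -> V -> W) :
  linear (tlift f).
Proof.
move=> a s t; rewrite /tlift scaler_sumr -big_split /=.
apply: eq_bigr => i _; rewrite scaler_sumr -big_split /=.
by apply: eq_bigr => j _; rewrite !mxE scalerDl scalerA.
Qed.

HB.instance Definition _ (U V W : vectType K) (f : U -> V -> W) :=
  GRing.isLinear.Build K (tensor U V) W _ (tlift f) (tlift_is_linear f).

Lemma tlift_tens (U V W : vectType K) (f : U -> V -> W) :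
  (forall v, linear (f^~ v)) -> (forall u, linear (f u)) ->
  forall u v, tlift f (tens u v) = f u v.
Proof.
move=> fl fr u v.
have fsl n (c : 'I_n -> K) (x : 'I_n -> U) w :
    f (\sum_i c i *: x i) w = \sum_i c i *: f (x i) w.
  pose g := HB.pack_for {linear U -> W} (f^~ w)
    (GRing.isLinear.Build K U W _ (f^~ w) (fl w)).
  by rewrite -[LHS]/(g _) linear_sum; apply: eq_bigr => i _; rewrite linearZ.
have fsr n (c : 'I_n -> K) (x : 'I_n -> V) w :
    f w (\sum_i c i *: x i) = \sum_i c i *: f w (x i).
  pose g := HB.pack_for {linear V -> W} (f w)
    (GRing.isLinear.Build K V W _ (f w) (fr w)).
  by rewrite -[LHS]/(g _) linear_sum; apply: eq_bigr => i _; rewrite linearZ.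
rewrite {2}(coord_vbasis (memvf u)) {2}(coord_vbasis (memvf v)) fsl.
apply: eq_bigr => i _; rewrite fsr scaler_sumr.
by apply: eq_bigr => j _; rewrite mxE scalerA.
Qed.

End Tensor.

HB.mixin Record isHopfAlgebra (K : fieldType) H of Falgebra K H := {
  comul_subdef : 'Hom(H, tensor H H);
  counit_subdef : 'Hom(H, K^o);
  antipode_subdef : 'End(H);
  comulA_subproof : forall h : H,
    tlift (fun a b => tens (comul_subdef a) b) (comul_subdef h) =
    tlift (fun a b => tlift (fun c d => tens (tens a c) d) (comul_subdef b))
          (comul_subdef h);
  counitl_subproof : forall h : H,
    tlift (fun a b => (counit_subdef a : K) *: b) (comul_subdef h) = h;
  counitr_subproof : forall h : H,
    tlift (fun a b => (counit_subdef b : K) *: a) (comul_subdef h) = h;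
  comulM_subproof : forall g h : H,
    comul_subdef (g * h) =
    tlift (fun a b => tlift (fun c d => tens (a * c) (b * d)) (comul_subdef h))
          (comul_subdef g);
  comul1_subproof : comul_subdef 1 = tens 1 1;
  counitM_subproof : forall g h : H,
    counit_subdef (g * h) = counit_subdef g * counit_subdef h;
  counit1_subproof : counit_subdef 1 = 1;
  antipodel_subproof : forall h : H,
    tlift (fun a b => antipode_subdef a * b) (comul_subdef h) =
    (counit_subdef h : K) *: 1;
  antipoder_subproof : forall h : H,
    tlift (fun a b => a * antipode_subdef b) (comul_subdef h) =
    (counit_subdef h : K) *: 1
}.

#[short(type="hopfAlgType")]
HB.structure Definition HopfAlgebra (K : fieldType) :=
  {H of Falgebra K H & isHopfAlgebra K H}.

Section HopfAxioms.
Variables (K : fieldType) (H : hopfAlgType K).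

Definition comul : 'Hom(H, tensor H H) := comul_subdef.
Definition counit : 'Hom(H, K^o) := counit_subdef.
Definition antipode : 'End(H) := antipode_subdef.

Lemma comulA : forall h : H,
    tlift (fun a b => tens (comul a) b) (comul h) =
    tlift (fun a b => tlift (fun c d => tens (tens a c) d) (comul b))
          (comul h).
Proof. exact: comulA_subproof. Qed.

Lemma counitl : forall h : H,
    tlift (fun a b => (counit a : K) *: b) (comul h) = h.
Proof. exact: counitl_subproof. Qed.

Lemma counitr : forall h : H,
    tlift (fun a b => (counit b : K) *: a) (comul h) = h.
Proof. exact: counitr_subproof. Qed.

Lemma comulM : forall g h : H,
    comul (g * h) =
    tlift (fun a b => tlift (fun c d => tens (a * c) (b * d)) (comul h))
          (comul g).
Proof. exact: comulM_subproof. Qed.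

Lemma comul1 : comul 1 = tens 1 1.
Proof. exact: comul1_subproof. Qed.

Lemma counitM : forall g h : H, counit (g * h) = counit g * counit h.
Proof. exact: counitM_subproof. Qed.

Lemma counit1 : counit 1 = 1.
Proof. exact: counit1_subproof. Qed.

Lemma antipodel : forall h : H,
    tlift (fun a b => antipode a * b) (comul h) = (counit h : K) *: 1.
Proof. exact: antipodel_subproof. Qed.

Lemma antipoder : forall h : H,
    tlift (fun a b => a * antipode b) (comul h) = (counit h : K) *: 1.
Proof. exact: antipoder_subproof. Qed.

End HopfAxioms.

Arguments comul {K H}.
Arguments counit {K H}.
Arguments antipode {K H}.

Section Modules.
Variables (K : fieldType) (H : falgType K).

Record is_module (V : vectType K) (rho : 'Hom(H, 'End(V))) : Prop := {
  module_act1 : rho 1 = \1%VF;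
  module_actM : forall g h : H, rho (g * h) = (rho g \o rho h)%VF
}.

Definition lftrace (V : vectType K) (f : 'End(V)) : K :=
  \tr (mxof (vbasis {:V}) (vbasis {:V}) f).

Definition character (V : vectType K) (rho : 'Hom(H, 'End(V))) (h : H) : K :=
  lftrace (rho h).

Definition is_left_ideal (I : {vspace H}) : Prop :=
  forall h x : H, x \in I -> h * x \in I.

(* Every submodule of the regular left module has a complement. *)
Definition semisimple : Prop :=
  forall I : {vspace H}, is_left_ideal I ->
  exists J : {vspace H},
    [/\ is_left_ideal J, (I + J)%VS = {:H}%VS & (I :&: J)%VS = 0%VS].

End Modules.

Section Integrals.
Variables (K : fieldType) (H : hopfAlgType K).

Record is_normalized_integral (L : H) : Prop := {
  integral_left : forall h : H, h * L = (counit h : K) *: L;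
  integral_right : forall h : H, L * h = (counit h : K) *: L;
  integral_counit : counit L = 1
}.

Lemma normalized_integral_uniq (L M : H) :
  is_normalized_integral L -> is_normalized_integral M -> L = M.
Proof.
move=> hL hM; rewrite -[M]scale1r -(integral_counit hL) -integral_left //.
by rewrite integral_right // integral_counit // scale1r.
Qed.

Lemma normalized_integral_exists :
  semisimple H -> exists L : H, is_normalized_integral L.
Proof.
move=> ssH.
have counitZ a (h : H) : counit (a *: h) = a * counit h by rewrite linearZ.
have kerP (h : H) : h \in lker (counit : 'Hom(H, K^o)) -> counit h = 0.
  by rewrite memv_ker => /eqP.
have kerI (h : H) : counit h = 0 -> h \in lker (counit : 'Hom(H, K^o)).
  by rewrite memv_ker => ->.
have kid : is_left_ideal (lker (counit : 'Hom(H, K^o))).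
  by move=> h x /kerP hx; apply: kerI; rewrite counitM hx mulr0.
have [J [Jid Jsum Jcap]] := ssH _ kid.
have : (1 : H) \in (lker (counit : 'Hom(H, K^o)) + J)%VS by rewrite Jsum memvf.
case/memv_addP => e /kerP he [L LJ eL].
have cL : counit L = 1.
  by rewrite -[RHS](@counit1 K H) eL linearD /= he add0r.
have lL (h : H) : h * L = (counit h : K) *: L.
  apply/eqP; rewrite -subr_eq0 -memv0 -Jcap memv_cap; apply/andP; split.
    by apply: kerI; rewrite linearB /= counitM counitZ cL subrr.
  by rewrite memvB ?memvZ // Jid.
exists L; split=> // h; apply/eqP; rewrite -subr_eq0; set y := _ - _.
have cy : counit y = 0 by rewrite linearB /= counitM counitZ cL mulrC subrr.
have ly (g : H) : g * y = (counit g : K) *: y.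
  by rewrite mulrBr mulrA lL scalerBr -scalerAl -scalerAr lL !scalerA mulrC.
have yid : is_left_ideal <[y]>%VS.
  by move=> g _ /vlineP[k ->]; rewrite -scalerAr ly !memvZ ?memv_line.
have [J' [J'id J'sum J'cap]] := ssH _ yid.
have : (1 : H) \in (<[y]> + J')%VS by rewrite J'sum memvf.
case/memv_addP => _ /vlineP[k ->] [j jJ ej].
rewrite -memv0 -J'cap memv_cap memv_line /=.
rewrite -[y]mulr1 ej mulrDr -scalerAr ly cy scale0r scaler0 add0r.
exact: J'id.
Qed.

(* h^[m] = h_(1) h_(2) ... h_(m), with h^[0] = counit(h) 1.                 *)
Fixpoint sweedler_pow (m : nat) (h : H) : H :=
  if m is m'.+1 then tlift (fun a b => a * sweedler_pow m' b) (comul h)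
  else (counit h : K) *: 1.

Definition fs_indicator (L : H) (m : nat) (chi : H -> K) : K :=
  chi (sweedler_pow m L).

End Integrals.

Section Dual.
Variables (K : fieldType) (H : hopfAlgType K).

Definition dual : vectType K := 'Hom(H, K^o).

Definition dual_basis (i : 'I_(\dim {:H})) : dual :=
  linfun (coord (vbasis {:H}) i : H -> K^o).

(* The convolution product (phi psi)(h) = phi(h_(1)) psi(h_(2)).               *)
Definition dual_mul (phi psi : dual) : dual :=
  linfun (fun h : H =>
    tlift (fun a b => (phi : 'Hom(H, K^o)) a * (psi : 'Hom(H, K^o)) b : K^o)
          (comul h)).

Lemma dual_mulE (phi psi : dual) (h : H) :
  (dual_mul phi psi : 'Hom(H, K^o)) h =
  tlift (fun a b => (phi : 'Hom(H, K^o)) a * (psi : 'Hom(H, K^o)) b : K^o)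
        (comul h).
Proof.
rewrite /dual_mul; set f := (X in linfun X).
have fl : linear f by move=> a x y; rewrite /f !linearP.
pose g := HB.pack_for {linear H -> K^o} f (GRing.isLinear.Build K H K^o _ f fl).
exact: (lfunE g).
Qed.

Definition dual_one : dual := counit.

(* The coproduct dual to the product of H, that is the one for which          *)
(* phi(g h) = phi_(1)(g) phi_(2)(h).                                          *)
Definition dual_comul (phi : dual) : tensor dual dual :=
  \sum_(i < \dim {:H}) \sum_(j < \dim {:H})
    (phi : 'Hom(H, K^o)) ((vbasis {:H})`_i * (vbasis {:H})`_j) *:
    tens (dual_basis i) (dual_basis j).

Lemma dual_comulE (phi : dual) (g h : H) :
  (phi : 'Hom(H, K^o)) (g * h) =
  tlift (fun a b : dual =>
    (a : 'Hom(H, K^o)) g * (b : 'Hom(H, K^o)) h : K^o) (dual_comul phi).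
Proof.
have be i x : (dual_basis i : 'Hom(H, K^o)) x = coord (vbasis {:H}) i x.
  pose c := HB.pack_for {linear H -> K^o} (coord (vbasis {:H}) i : H -> K^o)
    (GRing.isLinear.Build K H K^o _ _ (linearP (coord (vbasis {:H}) i))).
  exact: (lfunE c).
rewrite {1}(coord_vbasis (memvf g)) {1}(coord_vbasis (memvf h)).
rewrite mulr_suml !linear_sum /=; apply: eq_bigr => i _.
rewrite mulr_sumr !linear_sum /=; apply: eq_bigr => j _.
rewrite !linearZ /= tlift_tens; last 2 first.
- by move=> v a x y /=; rewrite add_lfunE scale_lfunE mulrDl -scalerAl.
- by move=> v a x y /=; rewrite add_lfunE scale_lfunE mulrDr -scalerAr.
rewrite !be -scalerAl -scalerAr !linearZ /= scalerA.
rewrite /GRing.scale /= -(@mulrA K); congr (_ * _); exact: (@mulrC K).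
Qed.

Definition dual_antipode : 'End(dual) :=
  linfun (fun phi : dual => (phi \o (antipode : 'End(H)))%VF : dual).

Lemma dual_antipodeE (phi : dual) :
  dual_antipode phi = (phi \o (antipode : 'End(H)))%VF.
Proof.
rewrite /dual_antipode; set f := (X in linfun X).
have fl : linear f.
  move=> a x y; apply/lfunP => h.
  by rewrite /f comp_lfunE !add_lfunE !scale_lfunE !comp_lfunE.
pose g := HB.pack_for {linear dual -> dual} f
  (GRing.isLinear.Build K dual dual _ f fl).
exact: (lfunE g).
Qed.

End Dual.

Section DrinfeldDouble.
Variables (K : fieldType) (H : hopfAlgType K).

Definition double : vectType K := tensor (dual H) H.

(* The antipode of a finite-dimensional Hopf algebra is bijective, so the     *)
(* library's (generalized) inverse of a linear map is its inverse.            *)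
Definition antipodeV : 'End(H) := ((antipode : 'End(H))^-1)%VF.
Definition dual_antipodeV : 'End(dual H) := ((dual_antipode H)^-1)%VF.

(* h_(1) (x) h_(2) (x) h_(3), and the same in the dual.                        *)
Definition sweedler3 (W : vectType K) (f : H -> H -> H -> W) (h : H) : W :=
  tlift (fun a b => tlift (fun c d => f a c d) (comul b)) (comul h).

Definition dual_sweedler3 (W : vectType K)
    (f : dual H -> dual H -> dual H -> W) (phi : dual H) : W :=
  tlift (fun a b => tlift (fun c d => f a c d) (dual_comul b)) (dual_comul phi).

(* (phi (x) h) (psi (x) k)                                                     *)
(*   = psi_(1)(S^-1 h_(3)) psi_(3)(h_(1)) phi psi_(2) (x) h_(2) k              *)
Definition double_mul_pure (phi : dual H) (h : H) (psi : dual H) (k : H) :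
    double :=
  sweedler3 (fun h1 h2 h3 =>
    dual_sweedler3 (fun p1 p2 p3 =>
      ((p1 : 'Hom(H, K^o)) (antipodeV h3) * (p3 : 'Hom(H, K^o)) h1 : K) *:
      tens (dual_mul phi p2) (h2 * k)) psi) h.

Definition double_mul (x y : double) : double :=
  tlift (fun phi h => tlift (fun psi k => double_mul_pure phi h psi k) y) x.

Definition double_one : double := tens (dual_one H) 1.

Definition double_pow (x : double) (m : nat) : double :=
  iter m (double_mul x) double_one.

Definition double_of (h : H) : double := tens (dual_one H) h.

Definition drinfeld_element : double :=
  \sum_(i < \dim {:H})
    tens (dual_antipodeV (dual_basis i)) (vbasis {:H})`_i.

End DrinfeldDouble.

Section Quotient.
Variables (K : fieldType) (W : vectType K) (U : {vspace W}).

(* W / U, realized on a complement of U, with its projection and a section.   *)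
Definition quotv : vectType K := subvs_of (U^C)%VS.

Definition quotv_proj : 'Hom(W, quotv) :=
  (linfun (vsproj (U^C)%VS) \o daddv_pi (U^C)%VS U)%VF.

Definition quotv_sect : 'Hom(quotv, W) := linfun vsval.

Lemma quotv_sectK x : quotv_proj (quotv_sect x) = x.
Proof.
rewrite comp_lfunE !lfunE /= daddv_pi_id ?subvsP ?vsvalK //.
by rewrite capvC capv_compl.
Qed.

Lemma lker_quotv_proj : lker quotv_proj = U.
Proof.
have cap0 : (U :&: U^C)%VS = 0%VS := capv_compl U.
have cap0' : (U^C :&: U)%VS = 0%VS by rewrite capvC.
apply/vspaceP => w; rewrite memv_ker comp_lfunE lfunE /=.
have dec : daddv_pi U U^C w + daddv_pi U^C U w = w.
  by apply: daddv_pi_add; rewrite ?addv_complf ?memvf.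
have -> : (vsproj U^C (daddv_pi U^C U w) == 0) = (daddv_pi U^C U w == 0).
  by rewrite -(inj_eq val_inj) /= vsprojK // memv_pi.
apply/eqP/idP => [e|wU].
  by rewrite -dec e addr0 memv_pi.
have e : daddv_pi U U^C w = w by apply: daddv_pi_id.
by apply: (addrI w); rewrite -{1}e dec addr0.
Qed.

End Quotient.

Section Induction.
Variables (K : fieldType) (H : hopfAlgType K) (V : vectType K).
Variable rho : 'Hom(H, 'End(V)).

(* D(H) (x)_H V is the quotient of D(H) (x) V by the span of the elements     *)
(* x h (x) v - x (x) h v.                                                     *)
Definition induced_rel_map :
    tensor (tensor (double H) H) V -> tensor (double H) V :=
  tlift (fun t v =>
    tlift (fun x h =>
      tens (double_mul x (double_of h)) v - tens x (rho h v)) t).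

Definition induced_rel : {vspace tensor (double H) V} :=
  limg (linfun induced_rel_map).

Definition induced : vectType K := quotv induced_rel.

Definition double_lmul (x : double H) : 'End(tensor (double H) V) :=
  linfun (tlift (fun y v => tens (double_mul x y) v)).

Definition induced_act (x : double H) : 'End(induced) :=
  (quotv_proj induced_rel \o double_lmul x \o quotv_sect induced_rel)%VF.

Definition induced_character (x : double H) : K := lftrace (induced_act x).

End Induction.

(* Main.v *)
(* D(H) (x)_H V is the space of maps F : H -> V, and if S^2 = id then u acts  *)
(* on it by (uF)(g) = S(g_(2)) F(g_(1)).  Hence u^m acts by                   *)
(* F |-> S((g_(2))^[m]) F(g_(1)), whose trace is chi(S(t^[m])), where t in H  *)
(* is the character of the regular representation of H^*.  If S^2 = id then t *)
(* is an integral, so t = dim(H) Lambda, and S fixes Lambda.                  *)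
(*                                                                            *)
(* That S^2 = id is the theorem of Larson and Radford.  The functional        *)
(* lam(h) = Tr(L_h S^2) is an integral of H^* with lam(Lambda) = 1.  Comparing*)
(* it with the regular character of H shows that S^2 = Ad(w), and comparing   *)
(* it with lam o S shows that S^4 = Ad(g^-1) with g grouplike, so that g w^2  *)
(* is central.  On each block of H, w thus rescales to an element of finite   *)
(* order, whose trace times that of its inverse is of the form |f(zeta)|^2,   *)
(* with f a polynomial with natural coefficients and zeta a root of unity.    *)
(* By positivity lam(1) = Tr(S^2) <> 0, whence g = 1 and S^4 = id.  Finally   *)
(* t^2 = dim(H) t and lam(t) = lam(1), so Tr(S^2) = dim(H) Tr(p S^2) for the  *)
(* idempotent p = L_t / dim(H), which commutes with the involution S^2; thus  *)
(* dim(H) divides the nonzero integer Tr(S^2), which forces S^2 = id.         *)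
Require Import Defs.
From HB Require Import structures.
From mathcomp Require Import all_boot all_order all_algebra all_field.
From mathcomp Require Import cyclic zify.
From Stdlib Require Import Classical.

Set Implicit Arguments.
Unset Strict Implicit.
Unset Printing Implicit Defensive.

Import Order.TTheory GRing.Theory Num.Theory.
Local Open Scope ring_scope.

(** * Multilinear maps *)

(** Through [ev], an element of D(H) is read as an endomorphism of H. The three dual factors in the
    product of D(H) then merge into one evaluation ([ev_mul]), right multiplication by H becomes
    pointwise ([ev_mul_double_of]), and u becomes S^-1 ([ev_drinfeld]). So the induced module is the
    space of linear maps H -> V. Once S^2 = id, the action of u^m there is explicit
    ([ind_act_drinfeld_pow]). Tracing over V first leaves the trace on H of y |-> phi(y_(2)) y_(1),
    with phi(h) = chi(S(h^[m])) ([induced_character_drinfeld_pow]). This trace is phi(t) = dim(H)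
    phi(Lambda) by [dual_chi_integral]. Finally S commutes with Sweedler powers and fixes Lambda, so
    S disappears.

    The substance is S^2 = id ([antipode_sqr]). The invariant functional [lam] has Nakayama
    automorphism S^2 ([lam_nakayama]), so comparison with the nondegenerate trace form makes S^2
    inner ([antipode_sqr_inner]); comparison with [lam] after S gives S^4 ([antipode4]). Block by
    block, Tr(S^2) is a combination of norms |f(zeta)|^2. The field K has no order, so positivity is
    taken from a positive definite integer matrix having the combination as an eigenvalue
    ([norm_sum_neq0]). Hence Tr(S^2) is nonzero ([lam1_neq0]), S^4 = id, and divisibility of Tr(S^2)
    by dim(H) finishes. *)

Definition lin (K : fieldType) (U V : lmodType K) (f : U -> V) : Prop :=
  forall a x y, f (a *: x + y) = a *: f x + f y.

Section Lin.
Variable K : fieldType.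
Implicit Types U V W : lmodType K.

Lemma lin_id U : lin (fun x : U => x).
Proof. by []. Qed.

Lemma lin_comp U V W (f : V -> W) (g : U -> V) :
  lin f -> lin g -> lin (fun x => f (g x)).
Proof. by move=> fl gl a x y; rewrite gl fl. Qed.

Lemma lin_coord (V : vectType K) n (e : n.-tuple V) i :
  lin (coord e i : V -> K^o).
Proof. by move=> a x y; rewrite linearP. Qed.

Lemma lin_lfun (U V : vectType K) (f : 'Hom(U, V)) : lin f.
Proof. by move=> a x y; rewrite linearP. Qed.

Lemma lin_scale U k : lin (fun x : U => k *: x).
Proof. by move=> a x y; rewrite scalerDr !scalerA mulrC. Qed.

Lemma lin_scaler U (v : U) : lin (fun k : K^o => (k : K) *: v).
Proof. by move=> a x y; rewrite scalerDl scalerA. Qed.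

Lemma lin_scalel U V (v : V) (f : U -> K^o) :
  lin f -> lin (fun x => (f x : K) *: v).
Proof. by move=> fl a x y; rewrite fl scalerDl scalerA. Qed.

Lemma lin_mull (A : algType K) (c : A) : lin (GRing.mul c).
Proof. by move=> a x y; rewrite mulrDr scalerAr. Qed.

Lemma lin_mulr (A : algType K) (c : A) : lin (fun x => x * c).
Proof. by move=> a x y; rewrite mulrDl scalerAl. Qed.

Lemma lin_kmull (c : K) : lin (GRing.mul c : K^o -> K^o).
Proof. by move=> a x y; rewrite mulrDr [in RHS]/GRing.scale /= mulrCA. Qed.

Lemma lin_kmulr (c : K) : lin ((fun x => x * c) : K^o -> K^o).
Proof. by move=> a x y; rewrite mulrDl [in RHS]/GRing.scale /= mulrA. Qed.

Lemma lin_add U V (f g : U -> V) : lin f -> lin g -> lin (fun x => f x + g x).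
Proof. by move=> fl gl a x y; rewrite fl gl scalerDr addrACA. Qed.

Lemma lin_opp U V (f : U -> V) : lin f -> lin (fun x => - f x).
Proof. by move=> fl a x y; rewrite fl opprD scalerN. Qed.

Lemma lin_bigsum (I : Type) (r : seq I) (P : pred I) U V (f : I -> U -> V) :
  (forall i, lin (f i)) -> lin (fun x => \sum_(i <- r | P i) f i x).
Proof.
move=> fl a x y; rewrite scaler_sumr -big_split.
by apply: eq_bigr => i _; rewrite fl.
Qed.

Lemma lin_tlift (U V : vectType K) W (W' : vectType K) (f : W -> U -> V -> W') t :
  (forall u v, lin (fun x => f x u v)) -> lin (fun x => tlift (f x) t).
Proof.
move=> fl a x y; rewrite /tlift scaler_sumr -big_split /=.
apply: eq_bigr => i _; rewrite scaler_sumr -big_split /=.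
apply: eq_bigr => j _; rewrite fl scalerDr !scalerA [a * _]mulrC.
by rewrite -scalerA.
Qed.

Lemma lin_tliftr (U V W : vectType K) (f : U -> V -> W) : lin (tlift f).
Proof. exact: tlift_is_linear. Qed.

Lemma lin_tensl (U V : vectType K) (v : V) : lin (fun u : U => tens u v).
Proof.
by move=> a x y; apply/matrixP => i j; rewrite !mxE linearP /= mulrDl mulrA.
Qed.

Lemma lin_tensr (U V : vectType K) (u : U) : lin (tens u : V -> _).
Proof.
by move=> a x y; apply/matrixP => i j; rewrite !mxE linearP /= mulrDr mulrCA.
Qed.

Lemma lin_sum U V (f : U -> V) : lin f ->
  forall (I : Type) (r : seq I) (P : pred I) F,
  f (\sum_(i <- r | P i) F i) = \sum_(i <- r | P i) f (F i).
Proof.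
move=> fl; have f0 : f 0 = 0.
  by have := fl (-1) 0 0; rewrite scaler0 addr0 scaleN1r addNr.
move=> I r P F; apply: (big_morph f) => // x y.
by have := fl 1 x y; rewrite !scale1r.
Qed.

Lemma lin0 U V (f : U -> V) : lin f -> f 0 = 0.
Proof. by move=> fl; have := lin_sum fl [::] predT id; rewrite !big_nil. Qed.

Lemma linZ U V (f : U -> V) : lin f -> forall k x, f (k *: x) = k *: f x.
Proof. by move=> fl k x; have := fl k x 0; rewrite (lin0 fl) !addr0. Qed.

Lemma linD U V (f : U -> V) : lin f -> forall x y, f (x + y) = f x + f y.
Proof. by move=> fl x y; have := fl 1 x y; rewrite !scale1r. Qed.

Lemma linN U V (f : U -> V) : lin f -> forall x, f (- x) = - f x.
Proof. by move=> fl x; rewrite -scaleN1r linZ // scaleN1r. Qed.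

Lemma linB U V (f : U -> V) : lin f -> forall x y, f (x - y) = f x - f y.
Proof. by move=> fl x y; rewrite linD // linN. Qed.

Lemma lin_tlift_pull (U V W W' : vectType K) (g : W -> W') (f : U -> V -> W) t :
  lin g -> g (tlift f t) = tlift (fun a b => g (f a b)) t.
Proof.
move=> gl; rewrite /tlift lin_sum //; apply: eq_bigr => i _.
by rewrite lin_sum //; apply: eq_bigr => j _; rewrite linZ.
Qed.

Lemma eq_tlift (U V W : vectType K) (f g : U -> V -> W) t :
  (forall a b, f a b = g a b) -> tlift f t = tlift g t.
Proof.
by move=> fg; apply: eq_bigr => i _; apply: eq_bigr => j _; rewrite fg.
Qed.

Lemma tliftE (U V W : vectType K) (f : U -> V -> W) u v :
  (forall v, lin (fun u => f u v)) -> (forall u, lin (f u)) ->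
  tlift f (tens u v) = f u v.
Proof. by move=> fl fr; rewrite tlift_tens. Qed.

Lemma tlift_bigsum (U V W : vectType K) (I : Type) (r : seq I) (P : pred I)
    (f : I -> U -> V -> W) t :
  tlift (fun a b => \sum_(i <- r | P i) f i a b) t =
  \sum_(i <- r | P i) tlift (f i) t.
Proof.
rewrite /tlift [RHS]exchange_big; apply: eq_bigr => i0 _.
by rewrite [RHS]exchange_big; apply: eq_bigr => j _; rewrite scaler_sumr.
Qed.

Lemma exchange_tlift (U V U' V' W : vectType K)
    (f : U -> V -> U' -> V' -> W) t s :
  tlift (fun a b => tlift (fun c d => f a b c d) s) t =
  tlift (fun c d => tlift (fun a b => f a b c d) t) s.
Proof.
transitivity (tlift (fun c d => \sum_i \sum_j (t : 'M_(_, _)) i j *: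
  f (vbasis {:U})`_i (vbasis {:V})`_j c d) s); last by [].
rewrite [RHS]tlift_bigsum; apply: eq_bigr => i _.
rewrite [RHS]tlift_bigsum; apply: eq_bigr => j _.
exact: (@lin_tlift_pull _ _ _ _ (fun x => (t : 'M_(_, _)) i j *: x) _ s
  (@lin_scale _ _)).
Qed.

Lemma lin_eval (U V : vectType K) (u : U) : lin (fun f : 'Hom(U, V) => f u).
Proof. by move=> a x y; rewrite add_lfunE scale_lfunE. Qed.

Lemma linfunE (U V : vectType K) (f : U -> V) : lin f -> linfun f =1 f.
Proof.
move=> fl x; pose g := HB.pack_for {linear U -> V} f
  (GRing.isLinear.Build K U V _ f fl).
exact: (lfunE g).
Qed.

Definition lin2 (U V W : lmodType K) (f : U -> V -> W) : Prop :=
  (forall b, lin (fun a => f a b)) /\ (forall a, lin (f a)).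

Definition lin3 (T U V W : lmodType K) (f : T -> U -> V -> W) : Prop :=
  [/\ forall b c, lin (fun a => f a b c), forall a c, lin (fun b => f a b c)
    & forall a b, lin (f a b)].

End Lin.

Create HintDb linearity.

Ltac lin_atom :=
  first [ assumption | solve [auto 1 with nocore linearity]
        | exact: lin_id | exact: lin_lfun | exact: lin_coord | exact: lin_scale
        | exact: lin_scaler | exact: lin_mull | exact: lin_mulr
        | exact: lin_kmull | exact: lin_kmulr | exact: lin_tliftr
        | exact: lin_tensl | exact: lin_tensr | exact: lin_eval
        | match goal with H : _ |- _ => exact: H end ].

(** An inner identity map is refused, since splitting it off would return the same goal forever. *)
Ltac lin_comp_with F G :=
  lazymatch G with
  | (fun x => x) => fail
  | _ => refine (@lin_comp _ _ _ _ F G _ _)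
  end.

Ltac lin_step :=
  cbv beta;
  first
  [ lazymatch goal with
    | |- forall _, _ => intro
    | |- lin2 _ => split
    | |- lin3 _ => split
    end
  | lin_atom
  | lazymatch goal with
    | |- lin (fun x => @tlift _ _ _ _ _ ?t) => apply: lin_tlift => ? ?
    | |- lin (fun x => _ + _) => apply: lin_add
    | |- lin (fun x => - _) => apply: lin_opp
    | |- lin (fun x => @GRing.scale _ _ (@?G x) ?v) => refine (lin_scalel v (f := G) _)
    | |- lin (fun x => \sum_(i <- _ | _) _) => apply: lin_bigsum => ?
    end
  | match goal with
    | |- lin (fun x => ?F (@?G x)) => lin_comp_with F G
    | |- lin (fun x => ?F (@?G x) ?c) => lin_comp_with (fun y => F y c) G
    | |- lin (fun x => ?F (@?G x) ?c ?d) => lin_comp_with (fun y => F y c d) G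
    end ].

(* Multilinearity side conditions are discharged by [//], through the hints. *)
Ltac lin := repeat lin_step.
Ltac by_lin := solve [lin].

#[export] Hint Extern 0 (lin _) => by_lin : core.
#[export] Hint Extern 0 (lin2 _) => by_lin : core.
#[export] Hint Extern 0 (lin3 _) => by_lin : core.

(** * Traces *)

Section Trace.
Variable K : fieldType.
Implicit Types U V W : vectType K.

Definition bas V (i : 'I_(\dim {:V})) : V := (vbasis {:V})`_i.
Definition crd V (i : 'I_(\dim {:V})) (v : V) : K^o := coord (vbasis {:V}) i v.

Lemma lin_crd V i : lin (@crd V i).
Proof. exact: lin_coord. Qed.

Lemma basE V (v : V) : v = \sum_i (crd i v : K) *: bas i.
Proof. exact: (coord_vbasis (memvf v)). Qed.

Lemma crd_bas V i j : @crd V i (bas j) = (i == j)%:R.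
Proof.
rewrite /crd /bas coord_free ?(basis_free (vbasisP _)) //.
by rewrite eq_sym.
Qed.

(* Traces of unbundled maps, so that Sweedler expressions can be traced. *)
Definition ltr V (f : V -> V) : K := \sum_i crd i (f (bas i)).

Lemma lftraceE V (f : 'End(V)) : lftrace f = ltr f.
Proof.
rewrite /lftrace /mxtrace /ltr; apply: eq_bigr => i _.
by rewrite !mxE /= passmx.vecof_delta.
Qed.

Lemma eq_ltr V (f g : V -> V) : f =1 g -> ltr f = ltr g.
Proof. by move=> fg; apply: eq_bigr => i _; rewrite fg. Qed.

Lemma ltr_cyc V W (P : V -> W) (Q : W -> V) : lin P -> lin Q ->
  ltr (fun x => Q (P x)) = ltr (fun y => P (Q y)).
Proof.
move=> Pl Ql; rewrite /ltr.
transitivity (\sum_i \sum_j crd j (P (bas i)) * crd i (Q (bas j))).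
  apply: eq_bigr => i _; rewrite {1}[P _]basE (lin_sum Ql) (lin_sum (lin_crd i)).
  by apply: eq_bigr => j _; rewrite (linZ Ql) (linZ (lin_crd i)).
rewrite exchange_big; apply: eq_bigr => j _.
rewrite [in RHS](basE (Q (bas j))) (lin_sum Pl) (lin_sum (lin_crd j)).
by apply: eq_bigr => i _; rewrite (linZ Pl) (linZ (lin_crd j)) /= mulrC.
Qed.

(** A resolution of the identity suffices to read off a trace; the [x i] may be dependent. The
    induced module can thus be traced on generators without first being given a basis. *)
Lemma ltr_resolution V (I : finType) (x : I -> V) (f : I -> V -> K^o) T :
  (forall i, lin (f i)) -> (forall v, v = \sum_i (f i v : K) *: x i) ->
  lin T -> ltr T = \sum_i f i (T (x i)).
Proof.
move=> fl fx Tl; rewrite /ltr.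
transitivity (\sum_j \sum_i f i (bas j) * crd j (T (x i))).
  apply: eq_bigr => j _; rewrite {1}[bas j]fx (lin_sum Tl) (lin_sum (lin_crd j)).
  by apply: eq_bigr => i _; rewrite (linZ Tl) (linZ (lin_crd j)).
rewrite exchange_big; apply: eq_bigr => i _.
rewrite [in RHS](basE (T (x i))) (lin_sum (fl i)).
by apply: eq_bigr => j _; rewrite (linZ (fl i)) /= mulrC.
Qed.

Lemma ltr_sum V (I : Type) (r : seq I) (P : pred I) (f : I -> V -> V) :
  ltr (fun x => \sum_(i <- r | P i) f i x) = \sum_(i <- r | P i) ltr (f i).
Proof.
rewrite /ltr exchange_big; apply: eq_bigr => j _.
by rewrite (lin_sum (lin_crd j)).
Qed.

Lemma ltrD V (f g : V -> V) : ltr (fun x => f x + g x) = ltr f + ltr g.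
Proof.
by rewrite /ltr -big_split; apply: eq_bigr => j _; rewrite (linD (lin_crd j)).
Qed.

Lemma ltrZ V k (f : V -> V) : ltr (fun x => k *: f x) = k * ltr f.
Proof.
by rewrite /ltr mulr_sumr; apply: eq_bigr => j _; rewrite (linZ (lin_crd j)).
Qed.

Lemma ltrN V (f : V -> V) : ltr (fun x => - f x) = - ltr f.
Proof.
by rewrite /ltr -sumrN; apply: eq_bigr => j _; rewrite (linN (lin_crd j)).
Qed.

Lemma ltr_id V : ltr (fun x : V => x) = (\dim {:V})%:R.
Proof.
rewrite /ltr; under eq_bigr => i _ do rewrite crd_bas eqxx.
by rewrite sumr_const card_ord.
Qed.

Lemma ltr_tlift (A B : vectType K) V (f : A -> B -> V -> V) t :
  ltr (fun x => tlift (fun a b => f a b x) t) =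
  tlift (fun a b => ltr (f a b) : K^o) t.
Proof.
rewrite ltr_sum; apply: eq_bigr => i _.
rewrite ltr_sum; apply: eq_bigr => j _.
by rewrite ltrZ.
Qed.

Lemma ltr_rank1 V (v : V) (f : V -> K^o) : lin f ->
  ltr (fun x => (f x : K) *: v) = f v.
Proof.
move=> fl; rewrite [in RHS](basE v) (lin_sum fl); apply: eq_bigr => i _.
by rewrite (linZ (lin_crd i)) (linZ fl); exact: mulrC.
Qed.

(** [e] factors as [Q] after [P] through the coordinates of its image, and [P] after [Q] is the
    identity there. Cyclicity of the trace then gives the rank. *)
Lemma ltr_idem V (e : V -> V) : lin e -> (forall x, e (e x) = e x) ->
  ltr e = (\dim (limg (linfun e)))%:R.
Proof.
move=> el ee; set U := limg _.
have eU x : e x \in U by rewrite -[e x](linfunE el) memv_img ?memvf.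
have eid x : x \in U -> e x = x.
  by case/memv_imgP => y _ ->; rewrite !linfunE.
pose Q (v : 'rV[K]_(\dim U)) : V := \sum_i v 0 i *: (vbasis U)`_i.
pose P (x : V) : 'rV[K]_(\dim U) := \row_i coord (vbasis U) i (e x).
have Pl : lin P.
  by move=> a x y; apply/rowP => i; rewrite !mxE el linearP.
have Ql : lin Q.
  move=> a x y; rewrite /Q scaler_sumr -big_split; apply: eq_bigr => i _.
  by rewrite !mxE scalerDl scalerA.
have QU v : Q v \in U.
  by apply: memv_suml => i _; rewrite memvZ // vbasis_mem // mem_nth // size_tuple.
have -> : ltr e = ltr (fun x => Q (P x)).
  apply: eq_ltr => x; rewrite {1}(coord_vbasis (eU x)).
  by apply: eq_bigr => i _; rewrite mxE.
rewrite ltr_cyc // (_ : ltr _ = ltr (fun v : 'rV[K]_(\dim U) => v)); last first.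
  apply: eq_ltr => v; apply/rowP => i; rewrite mxE eid // /Q.
  by rewrite coord_sum_free // (basis_free (vbasisP _)).
by rewrite ltr_id dimvf /dim /= mul1n.
Qed.

End Trace.

(** * Sweedler calculus *)

Notation "\sw_ ( a , b <- h ) E" := (tlift (fun a b => E) (comul h))
  (at level 36, E at level 36, a, b at level 0, h at level 50,
   format "\sw_ ( a ,  b  <-  h )  E") : ring_scope.

Section Sweedler.
Variables (K : fieldType) (H : hopfAlgType K).
Implicit Types (h g x y : H) (W : vectType K).

Local Notation S := (antipode : 'End(H)).
Local Notation eps := (counit : 'Hom(H, K^o)).

Lemma swA W (f : H -> H -> H -> W) h : lin3 f ->
  \sw_(a, b <- h) \sw_(c, d <- b) f a c d =
  \sw_(b, d <- h) \sw_(a, c <- b) f a c d.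
Proof.
case=> f1 f2 f3.
pose G := tlift (fun (t : tensor H H) d => tlift (fun a c => f a c d) t).
have Gl : lin G by exact: lin_tliftr.
have GE t d : G (tens t d) = tlift (fun a c => f a c d) t.
  by rewrite /G tliftE //.
have := congr1 G (comulA h); rewrite !(lin_tlift_pull _ _ Gl) => e.
transitivity (\sw_(a, b <- h) G (\sw_(c, d <- b) tens (tens a c) d)).
  apply: eq_tlift => a b; rewrite (lin_tlift_pull _ _ Gl).
  by apply: eq_tlift => c d; rewrite GE tliftE //.
rewrite -e; apply: eq_tlift => b d; exact: GE.
Qed.

Lemma sw_counitl W (f : H -> W) h : lin f ->
  \sw_(a, b <- h) ((eps a : K) *: f b) = f h.
Proof.
move=> fl; rewrite -[in RHS](counitl h) (lin_tlift_pull _ _ fl).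
by apply: eq_tlift => a b; rewrite (linZ fl).
Qed.

Lemma sw_counitr W (f : H -> W) h : lin f ->
  \sw_(a, b <- h) ((eps b : K) *: f a) = f h.
Proof.
move=> fl; rewrite -[in RHS](counitr h) (lin_tlift_pull _ _ fl).
by apply: eq_tlift => a b; rewrite (linZ fl).
Qed.

Lemma sw1 W (f : H -> H -> W) : lin2 f -> \sw_(a, b <- 1) f a b = f 1 1.
Proof. by case=> f1 f2; rewrite comul1 tliftE. Qed.

Lemma swM W (f : H -> H -> W) g h : lin2 f ->
  \sw_(a, b <- g * h) f a b = \sw_(a, b <- g) \sw_(c, d <- h) f (a * c) (b * d).
Proof.
case=> f1 f2; rewrite comulM (lin_tlift_pull _ _ (lin_tliftr _)).
apply: eq_tlift => a b; rewrite (lin_tlift_pull _ _ (lin_tliftr _)).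
by apply: eq_tlift => c d; rewrite tliftE.
Qed.

Lemma sw_antipodel W (f : H -> W) h : lin f ->
  \sw_(a, b <- h) f (S a * b) = (eps h : K) *: f 1.
Proof.
by move=> fl; rewrite -(linZ fl) -[in RHS]antipodel (lin_tlift_pull _ _ fl).
Qed.

Lemma sw_antipoder W (f : H -> W) h : lin f ->
  \sw_(a, b <- h) f (a * S b) = (eps h : K) *: f 1.
Proof.
by move=> fl; rewrite -(linZ fl) -[in RHS]antipoder (lin_tlift_pull _ _ fl).
Qed.

Lemma counit_antipode h : eps (S h) = eps h.
Proof.
have /= := @sw_antipodel K^o eps h (@lin_lfun _ _ _ _).
rewrite counit1 [_ *: _]mulr1 => <-.
rewrite -[in LHS](counitr h) (lin_tlift_pull _ _ (@lin_lfun _ _ _ _)).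
rewrite (lin_tlift_pull _ _ (@lin_lfun _ _ _ _)); apply: eq_tlift => a b.
by rewrite !(linZ (@lin_lfun _ _ _ _)) counitM mulrC.
Qed.

Lemma antipode1 : S 1 = 1.
Proof.
have := antipodel (1 : H); rewrite sw1 ?mulr1 ?counit1 ?scale1r //.
Qed.

(** Uniqueness of convolution inverses: both sides invert the product map. [E] places the product
    map between the two inverses; cancelling on its right leaves S(g h), cancelling on its left
    leaves S(h) S(g). *)
Lemma antipodeM g h : S (g * h) = S h * S g.
Proof.
pose E g1 g2 g3 h1 h2 h3 : H := S (g1 * h1) * (g2 * (h2 * S h3) * S g3).
transitivity (\sw_(g1, g' <- g) \sw_(g2, g3 <- g') \sw_(h1, h' <- h)
   \sw_(h2, h3 <- h') E g1 g2 g3 h1 h2 h3).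
  transitivity (\sw_(g1, g' <- g) \sw_(h1, h' <- h)
      (((eps h' : K) *: ((eps g' : K) *: S (g1 * h1))) : H)).
    under eq_tlift => g1 g' do rewrite sw_counitr //.
    by rewrite sw_counitr //.
  apply: eq_tlift => g1 g'; rewrite exchange_tlift; apply: eq_tlift => h1 h'.
  rewrite -[S (g1 * h1)]mulr1.
  rewrite -(@sw_antipoder _ (fun x => S (g1 * h1) * x) g') //.
  rewrite (lin_tlift_pull _ _ (@lin_scale _ _ _)); apply: eq_tlift => g2 g3.
  rewrite -{1}[g2]mulr1.
  by rewrite -(@sw_antipoder _ (fun x => S (g1 * h1) * (g2 * x * S g3)) h') //.
rewrite {1}/E swA //.
transitivity (\sw_(a, g3 <- g) \sw_(b, h3 <- h)
  (((eps (a * b) : K) *: (S h3 * S g3)) : H)); last first.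
  transitivity (\sw_(a, g3 <- g) (((eps a : K) *: (S h * S g3)) : H)).
    apply: eq_tlift => a g3.
    under eq_tlift => b h3 do rewrite counitM mulrC -scalerA.
    by rewrite sw_counitl //.
  by rewrite sw_counitl //.
apply: eq_tlift => a g3.
transitivity (\sw_(g1, g2 <- a) \sw_(b, h3 <- h) \sw_(h1, h2 <- b)
   E g1 g2 g3 h1 h2 h3).
  by apply: eq_tlift => g1 g2; rewrite /E swA //.
rewrite exchange_tlift; apply: eq_tlift => b h3.
rewrite -[S h3 * _]mul1r -(@sw_antipodel _ (fun x => x * (S h3 * S g3))) //.
rewrite swM //.
by apply: eq_tlift => g1 g2; apply: eq_tlift => h1 h2; rewrite /E !mulrA.
Qed.

(** The same uniqueness for convolution inverses of the coproduct. In [E], the middle factor c1 (x)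
    c2 cancels against S(c4) (x) S(c3) on one side, and against the coproduct of S(h_(1)) on the
    other. *)
Lemma sw_antipode W (f : H -> H -> W) h : lin2 f ->
  \sw_(a, b <- S h) f a b = \sw_(a, b <- h) f (S b) (S a).
Proof.
case=> f1 f2.
pose E a b c1 c2 c3 c4 := f (a * (c1 * S c4)) (b * (c2 * S c3)).
transitivity (\sw_(h1, h' <- h) \sw_(a, b <- S h1) \sw_(c1, h'' <- h')
  \sw_(c2, h3 <- h'') \sw_(c3, c4 <- h3) E a b c1 c2 c3 c4).
  transitivity (\sw_(h1, h' <- h) ((eps h' : K) *: \sw_(a, b <- S h1) f a b)).
    by rewrite sw_counitr //.
  apply: eq_tlift => h1 h'.
  rewrite (lin_tlift_pull _ _ (@lin_scale _ _ _)); apply: eq_tlift => a b.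
  under eq_tlift => c1 h''.
    rewrite /E swA //.
    under eq_tlift => d c4 do
      rewrite (@sw_antipoder _ (fun x => f (a * (c1 * S c4)) (b * x))) // mulr1.
    rewrite (@sw_counitl _ (fun x => f (a * (c1 * S x)) b)) //.
    over.
  by rewrite (@sw_antipoder _ (fun x => f (a * x) b)) // mulr1.
transitivity (\sw_(h1, h' <- h) \sw_(c, h3 <- h') \sw_(a, b <- S h1)
  \sw_(c1, c2 <- c) \sw_(c3, c4 <- h3) E a b c1 c2 c3 c4).
  apply: eq_tlift => h1 h'; rewrite [RHS]exchange_tlift; apply: eq_tlift => a b.
  by rewrite /E -swA.
rewrite /E swA //.
transitivity (\sw_(d, h3 <- h) ((eps d : K) *: \sw_(a, b <- h3) f (S b) (S a))).
  apply: eq_tlift => d h3.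
  pose F x := \sw_(a, b <- x) \sw_(c3, c4 <- h3) f (a * S c4) (b * S c3).
  transitivity (\sw_(h1, c <- d) F (S h1 * c)).
    apply: eq_tlift => h1 c; rewrite /F swM //.
    apply: eq_tlift => a b; apply: eq_tlift => c1 c2; apply: eq_tlift => c3 c4.
    by rewrite !mulrA.
  rewrite sw_antipodel; last by rewrite /F.
  rewrite /F sw1 //; congr (_ *: _); apply: eq_tlift => a b.
  by rewrite !mul1r.
by rewrite sw_counitl.
Qed.

End Sweedler.

(** * Invariant functionals *)

Section Integral.
Variables (K : fieldType) (H : hopfAlgType K) (L : H).
Hypothesis hL : is_normalized_integral L.
Implicit Types (h g x y : H) (W : vectType K).

Local Notation S := (antipode : 'End(H)).
Local Notation eps := (counit : 'Hom(H, K^o)).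

(** Insert h_(2) S(h_(3)) on the second leg: the coproduct of the first part of h then multiplies
    that of L and is absorbed by the integral. *)
Lemma sw_integralr W (f : H -> H -> W) h : lin2 f ->
  \sw_(a, b <- L) f (a * h) b = \sw_(a, b <- L) f a (b * S h).
Proof.
case=> f1 f2.
transitivity (\sw_(h1, h' <- h) \sw_(h2, h3 <- h')
    \sw_(a, b <- L) f (a * h1) (b * (h2 * S h3))).
  pose F u v := \sw_(a, b <- L) f (a * u) (b * v).
  transitivity (\sw_(h1, h' <- h) ((eps h' : K) *: F h1 1)).
    rewrite sw_counitr; last by rewrite /F.
    by apply: eq_tlift => a b; rewrite mulr1.
  by apply: eq_tlift => h1 h'; rewrite (@sw_antipoder _ _ _ (F h1)) // /F.
rewrite swA //.
transitivity (\sw_(d, h3 <- h) ((eps d : K) *: \sw_(a, b <- L) f a (b * S h3))).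
  apply: eq_tlift => d h3.
  rewrite -(linZ (@lin_tliftr _ _ _ _ _)) -(linZ (@lin_lfun _ _ _ _)).
  rewrite -(integral_right hL) swM //.
  rewrite exchange_tlift; apply: eq_tlift => a b; apply: eq_tlift => c e.
  by rewrite mulrA.
by rewrite sw_counitl.
Qed.

Lemma sw_integrall W (f : H -> H -> W) h : lin2 f ->
  \sw_(a, b <- L) f (S h * a) b = \sw_(a, b <- L) f a (h * b).
Proof.
case=> f1 f2.
transitivity (\sw_(h1, h' <- h) \sw_(h2, h3 <- h')
    \sw_(a, b <- L) f (S h1 * h2 * a) (h3 * b)).
  transitivity (\sw_(h1, h' <- h) ((eps h' : K) *:
      \sw_(a, b <- L) f (S h1 * a) b)).
    by rewrite sw_counitr.
  apply: eq_tlift => h1 h'.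
  rewrite -(linZ (@lin_tliftr _ _ _ _ _)) -(linZ (@lin_lfun _ _ _ _)).
  rewrite -(integral_left hL) swM //.
  apply: eq_tlift => a b; apply: eq_tlift => c e.
  by rewrite mulrA.
rewrite swA //.
pose F u v := \sw_(a, b <- L) f (u * a) (v * b).
transitivity (\sw_(d, h3 <- h) ((eps d : K) *: F 1 h3)).
  apply: eq_tlift => d h3.
  by rewrite (@sw_antipodel _ _ _ (fun u => F u h3)) // /F.
rewrite sw_counitl; last by rewrite /F.
by apply: eq_tlift => a b; rewrite mul1r.
Qed.

Definition lam h : K^o := ltr (fun y => h * S (S y)).

Lemma lin_lam : lin lam.
Proof.
move=> k x y; rewrite /lam /ltr scaler_sumr -big_split; apply: eq_bigr => i _.
by rewrite mulrDl -scalerAl lin_crd.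
Qed.


Local Hint Resolve lin_lam : linearity.

Definition left_invariant (mu : H -> K^o) : Prop :=
  lin mu /\ forall x, \sw_(a, b <- x) ((mu b : K) *: a) = (mu x : K) *: 1.

Definition right_invariant (mu : H -> K^o) : Prop :=
  lin mu /\ forall x, \sw_(a, b <- x) ((mu a : K) *: b) = (mu x : K) *: 1.

Lemma functional_ext (V : vectType K) (x y : V) :
  (forall phi : V -> K^o, lin phi -> phi x = phi y) -> x = y.
Proof.
move=> e; rewrite (basE x) (basE y); apply: eq_bigr => i _.
by rewrite (e _ (@lin_crd _ _ i)).
Qed.

(* Writing [x_(1) (x) x_(2) S^2(y)] as                                        *)
(* [(x S^2(y_(2)))_(1) S(y_(1)) (x) (x S^2(y_(2)))_(2)] turns the operator    *)
(* [y |-> x_(1) (x) x_(2) S^2(y)] into a composite, whose factors are         *)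
(* exchanged under the trace.                                                 *)
Lemma lam_left_invariant : left_invariant lam.
Proof.
split=> // x; apply: functional_ext => phi phil.
rewrite (linZ phil) (lin_tlift_pull _ _ phil).
pose Q k y := \sw_(y1, y2 <- y) ((crd k (S y1) : K) *: y2).
pose P k y := \sw_(c, d <- x * S (S y)) ((phi (c * bas k) : K) *: d).
have Pl k : lin (P k) by rewrite /P.
have crdl k : lin (@crd K H k) by exact: lin_crd.
have Ql k : lin (Q k) by rewrite /Q.
have phi_sum c z : \sum_k (crd k z : K) *: phi (c * bas k) = phi (c * z).
  rewrite [in RHS](basE z) mulr_sumr (lin_sum phil); apply: eq_bigr => k _.
  by rewrite -scalerAr (linZ phil).
transitivity (ltr (fun y => \sum_k P k (Q k y))).
  transitivity (ltr (fun y => \sw_(a, b <- x) ((phi a : K) *: (b * S (S y))))).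
    rewrite ltr_tlift; apply: eq_tlift => a b; rewrite (linZ phil) ltrZ.
    exact: mulrC.
  apply: (@eq_ltr K H) => y.
  transitivity (\sw_(y1, y2 <- y) \sw_(c, d <- x * S (S y2))
      ((phi (c * S y1) : K) *: d)); last first.
    transitivity (\sum_k \sw_(y1, y2 <- y) \sw_(c, d <- x * S (S y2))
      (((crd k (S y1) *: phi (c * bas k)) : K) *: d)).
      rewrite -tlift_bigsum; apply: eq_tlift => y1 y2.
      rewrite -tlift_bigsum; apply: eq_tlift => c d.
      by rewrite -scaler_suml phi_sum.
    apply: eq_bigr => k _; rewrite /Q (lin_tlift_pull _ _ (Pl k)).
    apply: eq_tlift => y1 y2; rewrite (linZ (Pl k)) /P.
    rewrite (lin_tlift_pull _ _ (@lin_scale _ _ _)).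
    by apply: eq_tlift => c d; rewrite scalerA.
  transitivity (\sw_(y1, y2 <- y) \sw_(e, f <- y2) \sw_(a, b <- x)
      ((phi (a * S (y1 * S e)) : K) *: (b * S (S f)))); last first.
    apply: eq_tlift => y1 y2; rewrite swM // exchange_tlift.
    apply: eq_tlift => a b; rewrite !sw_antipode //.
    by apply: eq_tlift => e f; rewrite antipodeM mulrA.
  rewrite swA //.
  transitivity (\sw_(z, f <- y) ((eps z : K) *:
     \sw_(a, b <- x) ((phi a : K) *: (b * S (S f))))); first by rewrite sw_counitl.
  apply: eq_tlift => z f.
  rewrite (@sw_antipoder _ _ _ (fun u => \sw_(a, b <- x)
    ((phi (a * S u) : K) *: (b * S (S f))))) //.
  by congr (_ *: _); apply: eq_tlift => a b; rewrite antipode1 mulr1.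
rewrite ltr_sum; under eq_bigr => k _ do rewrite (ltr_cyc (Ql k) (Pl k)).
rewrite -ltr_sum; apply: (etrans _ (mulrC (phi 1 : K) (lam x))).
rewrite /lam -ltrZ; apply: (@eq_ltr K H) => y.
transitivity (\sw_(c, d <- x * S (S y)) \sw_(d1, d2 <- d)
  ((phi (c * S d1) : K) *: d2)).
  rewrite -/(P _ _).
  transitivity (\sum_k \sw_(c, d <- x * S (S y)) \sw_(d1, d2 <- d)
     (((crd k (S d1) *: phi (c * bas k)) : K) *: d2)).
    apply: eq_bigr => k _; rewrite /P (lin_tlift_pull _ _ (Ql k)).
    apply: eq_tlift => c d; rewrite (linZ (Ql k)) /Q.
    rewrite (lin_tlift_pull _ _ (@lin_scale _ _ _)).
    by apply: eq_tlift => d1 d2; rewrite scalerA mulrC.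
  rewrite -tlift_bigsum; apply: eq_tlift => c d.
  rewrite -tlift_bigsum; apply: eq_tlift => d1 d2.
  by rewrite -scaler_suml phi_sum.
rewrite swA //; under eq_tlift => c d do rewrite
  (@sw_antipoder _ _ _ (fun u => (phi u : K) *: d)) //.
by rewrite (@sw_counitl _ _ _ (fun u => (phi 1 : K) *: u)).
Qed.

End Integral.

#[export] Hint Resolve lin_lam : linearity.

(** * Duality between the integral and [lam], and Radford's formula *)

Section Integral2.
Variables (K : fieldType) (H : hopfAlgType K) (L : H).
Hypothesis hL : is_normalized_integral L.
Implicit Types (h x y : H) (W : vectType K).

Local Notation S := (antipode : 'End(H)).
Local Notation eps := (counit : 'Hom(H, K^o)).

Lemma lam_integral : lam L = 1.
Proof.
have e y : L * S (S y) = (eps y : K) *: L.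
  by rewrite (integral_right hL) !counit_antipode.
rewrite /lam (eq_ltr e) ltr_rank1 ?(integral_counit hL) //.
Qed.

(** The integral moves S(h) to the first leg, where it becomes a right factor h; invariance of [mu]
    then removes the coproduct. So [mu] and the coproduct of L are dual to each other up to S. *)
Lemma left_invariant_dualr (mu : H -> K^o) h : left_invariant mu ->
  \sw_(a, b <- L) ((mu (b * S h) : K) *: a) = (mu L : K) *: h.
Proof.
case=> mul mui; rewrite -(@sw_integralr _ _ _ hL _ (fun a b => (mu b : K) *: a)) //.
transitivity ((\sw_(a, b <- L) ((mu b : K) *: a)) * h).
  rewrite (lin_tlift_pull _ _ (@lin_mulr _ _ h)).
  by apply: eq_tlift => a b; rewrite scalerAl.
by rewrite mui -scalerAl mul1r.
Qed.

Lemma left_invariant_duall (mu : H -> K^o) h : left_invariant mu ->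
  \sw_(a, b <- L) ((mu (h * b) : K) *: a) = (mu L : K) *: S h.
Proof.
case=> mul mui; rewrite -(@sw_integrall _ _ _ hL _ (fun a b => (mu b : K) *: a)) //.
transitivity (S h * (\sw_(a, b <- L) ((mu b : K) *: a))).
  rewrite (lin_tlift_pull _ _ (@lin_mull _ _ (S h))).
  by apply: eq_tlift => a b; rewrite scalerAr.
by rewrite mui -scalerAr mulr1.
Qed.

Lemma lam_dualr h : \sw_(a, b <- L) ((lam (b * S h) : K) *: a) = h.
Proof.
by rewrite left_invariant_dualr ?lam_integral ?scale1r //; exact: lam_left_invariant.
Qed.

Lemma lam_duall h : \sw_(a, b <- L) ((lam (h * b) : K) *: a) = S h.
Proof.
by rewrite left_invariant_duall ?lam_integral ?scale1r //; exact: lam_left_invariant.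
Qed.

(** [lam_dualr] reconstructs h from S(h). Hence [antipodeV] is a true two-sided inverse. *)
Lemma antipode_inj : injective S.
Proof.
move=> x y e; rewrite -(lam_dualr x) -(lam_dualr y).
by apply: eq_tlift => a b; rewrite e.
Qed.

Lemma antipode_lker0 : lker S == 0%VS.
Proof. by apply/lker0P; exact: antipode_inj. Qed.

Lemma antipodeK x : antipodeV H (S x) = x.
Proof. exact: (lker0_lfunK antipode_lker0). Qed.

Lemma antipodeVK x : S (antipodeV H x) = x.
Proof. exact: (lker0_lfunVK antipode_lker0). Qed.

Lemma lam_nondeg z : (forall x, lam (x * z) = 0) -> z = 0.
Proof.
move=> e; suff : antipodeV H z = 0.
  by move/(congr1 S); rewrite antipodeVK linear0.
rewrite -(lam_dualr (antipodeV H z)) antipodeVK.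
rewrite (eq_tlift (g := fun a b => 0)) => [|a b]; last by rewrite e scale0r.
by rewrite /tlift big1 // => i _; rewrite big1 // => j _; rewrite scaler0.
Qed.

Lemma antipode_integral : S L = L.
Proof.
apply: normalized_integral_uniq hL; split=> [h|h|].
- rewrite -{1}(antipodeVK h) -antipodeM (integral_right hL) (linZ (@lin_lfun _ _ _ _)).
  by rewrite -{2}(antipodeVK h) counit_antipode.
- rewrite -{1}(antipodeVK h) -antipodeM (integral_left hL) (linZ (@lin_lfun _ _ _ _)).
  by rewrite -{2}(antipodeVK h) counit_antipode.
- by rewrite counit_antipode (integral_counit hL).
Qed.

Lemma right_invariant_antipode (mu : H -> K^o) :
  right_invariant mu -> left_invariant (fun x => mu (S x)).
Proof.
case=> mul mui; split=> // x; apply: antipode_inj.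
rewrite (lin_tlift_pull _ _ (@lin_lfun _ _ _ S)) (linZ (@lin_lfun _ _ _ _)).
rewrite antipode1 -mui sw_antipode //; apply: eq_tlift => a b.
by rewrite (linZ (@lin_lfun _ _ _ _)).
Qed.

Lemma left_invariant_antipode (mu : H -> K^o) :
  left_invariant mu -> right_invariant (fun x => mu (S x)).
Proof.
case=> mul mui; split=> // x; apply: antipode_inj.
rewrite (lin_tlift_pull _ _ (@lin_lfun _ _ _ S)) (linZ (@lin_lfun _ _ _ _)).
rewrite antipode1 -mui sw_antipode //; apply: eq_tlift => a b.
by rewrite (linZ (@lin_lfun _ _ _ _)).
Qed.

(** The coproduct of L is a nondegenerate tensor: [lam] after S reconstructs any y from it, so D(y)
    is a value of [lam] after S at an element having the contraction of D as a factor. *)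
Lemma sw_integral_inj (D : H -> K^o) : lin D ->
  \sw_(a, b <- L) ((D b : K) *: a) = 0 -> forall y, D y = 0.
Proof.
move=> Dl D0 y; have [mul mui] := left_invariant_antipode (@lam_left_invariant K H).
have -> : y = \sw_(a, b <- L) ((lam (S (S y * a)) : K) *: b).
  rewrite (@sw_integrall _ _ _ hL _ (fun a b => (lam (S a) : K) *: b)) //.
  transitivity (y * (\sw_(a, b <- L) ((lam (S a) : K) *: b))).
    by rewrite mui antipode_integral lam_integral scale1r mulr1.
  rewrite (lin_tlift_pull _ _ (@lin_mull _ _ y)).
  by apply: eq_tlift => a b; rewrite scalerAr.
rewrite (lin_tlift_pull _ _ Dl).
transitivity (lam (S (S y * (\sw_(a, b <- L) ((D b : K) *: a))))); last first.
  by rewrite D0 mulr0 !linear0 (lin0 (@lin_lam K H)).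
have fl : lin (fun u => lam (S (S y * u))) by [].
rewrite [RHS](lin_tlift_pull _ _ fl); apply: eq_tlift => a b.
by rewrite (linZ Dl) (linZ fl); exact: mulrC.
Qed.

(** By invariance, [mu] and mu(L) [lam] have the same contraction with the coproduct of L, namely
    mu(L) 1. *)
Lemma left_invariant_uniq (mu : H -> K^o) : left_invariant mu ->
  forall x, mu x = mu L * lam x.
Proof.
move=> muP x; apply/eqP; rewrite -subr_eq0; apply/eqP.
have mul := muP.1.
apply: (@sw_integral_inj (fun x => mu x - mu L * lam x)) => //.
transitivity (\sw_(a, b <- L) ((mu (b * S 1) : K) *: a) -
   (mu L : K) *: \sw_(a, b <- L) ((lam (b * S 1) : K) *: a)).
  rewrite (lin_tlift_pull _ _ (@lin_scale _ _ _)) -[- _]scaleN1r.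
  rewrite (lin_tlift_pull _ _ (@lin_scale _ _ _)) /tlift -big_split.
  apply: eq_bigr => i _; rewrite -big_split; apply: eq_bigr => j _ /=.
  rewrite -scalerDr; congr (_ *: _).
  by rewrite antipode1 mulr1 scaleN1r scalerA -scalerBl.
by rewrite left_invariant_dualr // lam_dualr subrr.
Qed.

(** As functionals of y, both sides contract with the coproduct of L to S(x). Thus S^2 is the
    Nakayama automorphism of the form given by [lam]. *)
Lemma lam_nakayama x y : lam (x * y) = lam (y * S (S x)).
Proof.
apply/eqP; rewrite -subr_eq0; apply/eqP.
apply: (@sw_integral_inj (fun y => lam (x * y) - lam (y * S (S x)))) => //.
transitivity (\sw_(a, b <- L) ((lam (x * b) : K) *: a) -
  \sw_(a, b <- L) ((lam (b * S (S x)) : K) *: a)).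
  rewrite -[- _]scaleN1r (lin_tlift_pull _ _ (@lin_scale _ _ _)) /tlift -big_split.
  apply: eq_bigr => i _; rewrite -big_split; apply: eq_bigr => j _ /=.
  by rewrite -scalerDr; congr (_ *: _); rewrite scaleN1r -scalerBl.
by rewrite lam_duall lam_dualr subrr.
Qed.

(** The distinguished grouplike element of H: it measures how far the left-invariant [lam] is from
    being right-invariant ([sw_lam]). *)
Definition modular : H := \sw_(a, b <- L) ((lam a : K) *: b).
Local Notation g := modular.

(** For every phi, the convolution product of [lam] with phi is again left-invariant, hence a
    multiple of [lam]. *)
Lemma sw_lam x : \sw_(a, b <- x) ((lam a : K) *: b) = (lam x : K) *: g.
Proof.
apply: functional_ext => phi phil.
rewrite (linZ phil) (lin_tlift_pull _ _ phil).
pose nu x : K^o := \sw_(a, b <- x) (lam a * phi b : K^o).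
have nuP : left_invariant nu.
  split=> [|y]; first by rewrite /nu.
  have nul : lin nu by rewrite /nu.
  transitivity (\sw_(c, d <- y) \sw_(a, b <- d) (((lam a * phi b : K^o) : K) *: c)).
    apply: eq_tlift => c d.
    by rewrite /nu (lin_tlift_pull _ _ (@lin_scaler _ _ _)).
  rewrite swA //.
  transitivity (\sw_(z, b <- y) ((phi b : K) *: \sw_(c, a <- z) ((lam a : K) *: c))).
    apply: eq_tlift => z b; rewrite (lin_tlift_pull _ _ (@lin_scale _ _ _)).
    by apply: eq_tlift => c a; rewrite scalerA mulrC.
  rewrite /nu (lin_tlift_pull _ _ (@lin_scaler _ _ _)); apply: eq_tlift => z b.
  by rewrite ((@lam_left_invariant K H).2 z) scalerA mulrC.
have := left_invariant_uniq nuP x; rewrite {1}/nu => e.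
transitivity (nu L * lam x).
  by rewrite -e; apply: eq_tlift => a b; rewrite (linZ phil).
rewrite mulrC /modular (lin_tlift_pull _ _ phil); congr (_ * _).
by apply: eq_tlift => a b; rewrite (linZ phil).
Qed.

Lemma sw_modular W (f : H -> H -> W) : lin2 f -> \sw_(a, b <- g) f a b = f g g.
Proof.
case=> f1 f2.
rewrite {1}/modular (lin_tlift_pull _ _ (@lin_lfun _ _ _ _)).
rewrite (lin_tlift_pull _ _ (@lin_tliftr _ _ _ _ _)).
transitivity (\sw_(a, b <- L) \sw_(c, d <- b) ((lam a : K) *: f c d)).
  apply: eq_tlift => a b; rewrite (linZ (@lin_lfun _ _ _ _)).
  rewrite (linZ (@lin_tliftr _ _ _ _ _)).
  by rewrite (lin_tlift_pull _ _ (@lin_scale _ _ _)).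
rewrite swA //.
transitivity (\sw_(z, d <- L) ((lam z : K) *: f g d)).
  apply: eq_tlift => z d; rewrite -(linZ (f1 d)) -sw_lam.
  by rewrite (lin_tlift_pull _ _ (f1 d)); apply: eq_tlift => a c; rewrite (linZ (f1 d)).
rewrite {3}/modular (lin_tlift_pull _ _ (f2 g)).
by apply: eq_tlift => a c; rewrite (linZ (f2 _)).
Qed.

Lemma counit_modular : eps g = 1.
Proof.
rewrite /modular (lin_tlift_pull _ _ (@lin_lfun _ _ _ _)) -lam_integral.
rewrite -(@sw_counitr _ _ _ (@lam K H)) //; apply: eq_tlift => a b.
by rewrite (linZ (@lin_lfun _ _ _ _)); exact: mulrC.
Qed.

Lemma mul_antipode_modular : S g * g = 1.
Proof.
by have := antipodel g; rewrite sw_modular // counit_modular scale1r.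
Qed.

Lemma mul_modular_antipode : g * S g = 1.
Proof.
by have := antipoder g; rewrite sw_modular // counit_modular scale1r.
Qed.

Lemma antipode_sqr_modular : S (S g) = g.
Proof.
rewrite -[LHS]mulr1 -mul_antipode_modular mulrA -antipodeM mul_modular_antipode.
by rewrite antipode1 mul1r.
Qed.

(** [nu] is right-invariant because g is grouplike, so [nu] after S is left-invariant and equals
    [lam]. So does [lam] after S^2; compare the two at S^-1(x). *)
Lemma lam_antipode x : lam (S x) = lam (x * g).
Proof.
pose nu x := lam (x * g).
have nul : lin nu by rewrite /nu.
have nuP : right_invariant nu.
  split=> // y.
  transitivity ((\sw_(a, b <- y) ((nu a : K) *: (b * g))) * S g).
    rewrite (lin_tlift_pull _ _ (@lin_mulr _ _ _)); apply: eq_tlift => a b.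
    by rewrite -scalerAl -mulrA mul_modular_antipode mulr1.
  transitivity ((\sw_(a, b <- y * g) ((lam a : K) *: b)) * S g).
    rewrite swM //; congr (_ * _); apply: eq_tlift => a b.
    by rewrite sw_modular.
  by rewrite sw_lam -scalerAl mul_modular_antipode.
have e1 := left_invariant_uniq (right_invariant_antipode nuP).
have e2 := left_invariant_uniq (right_invariant_antipode
  (left_invariant_antipode (@lam_left_invariant K H))).
have nuL : nu L = 1.
  by rewrite /nu (integral_right hL) counit_modular scale1r lam_integral.
rewrite -(antipodeVK x) e2 !antipode_integral lam_integral mul1r.
by have := e1 (antipodeV H x); rewrite antipode_integral nuL mul1r.
Qed.

(* Radford's formula for S^4, for a unimodular Hopf algebra. *)
Lemma antipode4 y : y * g = g * S (S (S (S y))).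
Proof.
apply/eqP; rewrite -subr_eq0; apply/eqP; apply: lam_nondeg => x.
rewrite mulrBr (linB (@lin_lam K H)); apply/eqP; rewrite subr_eq0; apply/eqP.
transitivity (lam (S (x * y))); first by rewrite lam_antipode mulrA.
rewrite antipodeM lam_nakayama -!antipodeM lam_antipode -mulrA lam_nakayama.
by rewrite mulrA.
Qed.

End Integral2.

(** * Semisimple algebras *)

Lemma lin_inj_surj (K : fieldType) (U V : vectType K) (P : U -> V) :
  lin P -> (forall u, P u = 0 -> u = 0) -> \dim {:U} = \dim {:V} ->
  forall v, exists u, P u = v.
Proof.
move=> Pl Pi dUV v.
have k0 : (lker (linfun P) == 0)%VS.
  rewrite -subv0; apply/subvP => u; rewrite memv_ker linfunE // => /eqP /Pi ->.
  exact: mem0v.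
exists ((linfun P)^-1%VF v); rewrite -(linfunE Pl).
rewrite limg_lfunVK //; suff -> : limg (linfun P) = fullv by exact: memvf.
apply/eqP; rewrite eqEdim subvf -dUV /=.
by rewrite -[X in (X <= _)%N](limg_ker_dim (linfun P)) (eqP k0) capv0 dimv0.
Qed.

Lemma lin_not_inj (K : fieldType) (U V : vectType K) (P : U -> V) :
  lin P -> (\dim {:V} < \dim {:U})%N -> exists2 u, u != 0 & P u = 0.
Proof.
move=> Pl dUV; have [k0|] := eqVneq (lker (linfun P)) 0%VS.
  have := limg_ker_dim (linfun P) {:U}.
  rewrite k0 capv0 dimv0 add0n => e; move: dUV; rewrite -e ltnNge dimvS //.
  exact: subvf.
move=> k0; exists (vpick (lker (linfun P))); first by rewrite vpick0.
by apply/eqP; rewrite -(linfunE Pl) -memv_ker memv_pick.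
Qed.

Section SemisimpleAlgebra.
Variables (K : fieldType) (charK : [pchar K] =i pred0) (A : falgType K).
Hypothesis ssA : semisimple A.
Implicit Types (a c e h x y z : A).

Lemma natr_inj0 n : (n%:R == 0 :> K) = (n == 0)%N.
Proof. by move: n; apply/pcharf0P. Qed.

Lemma natr_inj m n : (m%:R == n%:R :> K) = (m == n).
Proof.
wlog mn : m n / (m <= n)%N => [w|].
  by case/orP: (leq_total m n) => /w //; rewrite eq_sym [in RHS]eq_sym.
by rewrite eq_sym -subr_eq0 -natrB // natr_inj0 subn_eq0 eqn_leq mn.
Qed.

Definition chiR x : K^o := ltr (fun y => x * y).

Lemma lin_chiR : lin chiR.
Proof.
move=> k x y; rewrite /chiR /ltr scaler_sumr -big_split; apply: eq_bigr => i _.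
by rewrite mulrDl -scalerAl lin_crd.
Qed.

Local Hint Resolve lin_chiR : linearity.

Lemma chiRC x y : chiR (x * y) = chiR (y * x).
Proof.
transitivity (ltr (fun a => x * (y * a))); first by apply: (@eq_ltr K A) => a; rewrite mulrA.
rewrite (ltr_cyc (lin_mull y) (lin_mull x)).
by apply: (@eq_ltr K A) => a; rewrite mulrA.
Qed.

Lemma chiR_idem e : e * e = e -> exists2 n, chiR e = n%:R & (n == 0)%N -> e = 0.
Proof.
move=> ee; exists (\dim (limg (linfun (GRing.mul e)))).
  by apply: (ltr_idem (lin_mull e)) => x; rewrite mulrA ee.
have := memv_img (linfun (GRing.mul e)) (memvf 1).
by rewrite dimv_eq0 linfunE // mulr1 => + /eqP l0; rewrite l0 memv0 => /eqP.
Qed.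

Lemma ideal_idem (I : {vspace A}) : is_left_ideal I ->
  exists2 e, e \in I & forall x, x \in I -> x * e = x.
Proof.
move=> Iid; have [J [Jid IJ IJ0]] := ssA Iid.
have : 1 \in (I + J)%VS by rewrite IJ memvf.
case/memv_addP => e eI [f fJ e1]; exists e => // x xI.
have xf : x * f = x - x * e by rewrite -[X in X - _]mulr1 e1 mulrDr addrC addKr.
apply/eqP; rewrite eq_sym -subr_eq0 -xf -memv0 -IJ0 memv_cap Jid // andbT.
by rewrite xf memvB // Iid.
Qed.

(** The radical of the trace form is a left ideal, so it has an idempotent right unit e, and chiR(e)
    = 0. But chiR(e) is a rank, so in characteristic zero e = 0 and the radical vanishes. *)
Lemma chiR_nondeg x : (forall y, chiR (x * y) = 0) -> x = 0.
Proof.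
pose P x : 'rV[K]_(\dim {:A}) := \row_j chiR (x * bas j).
have Pl : lin P.
  by move=> k u v; apply/rowP => j; rewrite !mxE mulrDl -scalerAl lin_chiR.
have PE u : reflect (forall y, chiR (u * y) = 0) (u \in lker (linfun P)).
  rewrite memv_ker linfunE //; apply: (iffP eqP) => [/rowP P0 y|u0].
    rewrite (basE y) mulr_sumr (lin_sum lin_chiR) big1 // => j _.
    by have := P0 j; rewrite !mxE -scalerAr (linZ lin_chiR) => ->; rewrite scaler0.
  by apply/rowP => j; rewrite !mxE u0.
have Iid : is_left_ideal (lker (linfun P)).
  move=> h u /PE u0; apply/PE => y.
  by rewrite chiRC mulrA chiRC u0.
have [e eI eP] := ideal_idem Iid.
have [n ne n0] := chiR_idem (eP _ eI).
move=> /PE xI; rewrite -(eP _ xI) n0 ?mulr0 //.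
by rewrite -natr_inj0 -ne -[e]mulr1; apply/eqP/PE.
Qed.

Lemma chiR_repr (f : A -> K^o) : lin f -> exists c, forall x, f x = chiR (c * x).
Proof.
move=> fl; pose P x : 'rV[K]_(\dim {:A}) := \row_j chiR (x * bas j).
have Pl : lin P.
  by move=> k u v; apply/rowP => j; rewrite !mxE mulrDl -scalerAl lin_chiR.
have [||c cE] := lin_inj_surj Pl _ _ (\row_j f (bas j)).
- move=> u /rowP P0; apply: chiR_nondeg => y.
  rewrite (basE y) mulr_sumr (lin_sum lin_chiR) big1 // => j _.
  by have := P0 j; rewrite !mxE -scalerAr (linZ lin_chiR) => ->; rewrite scaler0.
- by rewrite [RHS]dimvf /dim /= mul1n.
exists c => x; rewrite (basE x) mulr_sumr (lin_sum lin_chiR) (lin_sum fl).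
apply: eq_bigr => j _; rewrite -scalerAr (linZ lin_chiR) (linZ fl).
by have /rowP/(_ j) := cE; rewrite !mxE => ->.
Qed.

Definition central c : Prop := forall x, c * x = x * c.

Lemma chiR_repr_central (f : A -> K^o) : lin f ->
  (forall x y, f (x * y) = f (y * x)) ->
  exists2 c, central c & forall x, f x = chiR (c * x).
Proof.
move=> fl fC; have [c cE] := chiR_repr fl; exists c => // x.
apply/eqP; rewrite -subr_eq0; apply/eqP; apply: chiR_nondeg => y.
rewrite mulrBl (linB lin_chiR); apply/eqP; rewrite subr_eq0; apply/eqP.
by rewrite -mulrA -cE fC cE mulrA chiRC mulrA.
Qed.

Record central_idem z : Prop := {
  central_idemC : central z;
  central_idemM : z * z = z
}.

(** A block is characterised by the centre acting on it through scalars, which stands in for an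
    identification with a matrix algebra. *)
Record primitive z : Prop := {
  primitive_idem : central_idem z;
  primitive_neq0 : z != 0;
  primitive_scalar : forall c, central c -> exists k : K, c * z = k *: z
}.

Lemma chiR_neq0 e : e * e = e -> e != 0 -> chiR e != 0.
Proof.
move=> ee; have [n -> n0] := chiR_idem ee; rewrite natr_inj0.
by apply: contra => /n0 ->.
Qed.

(* On the block of z, a bilinear form that is a trace function in either      *)
(* argument is a multiple of the product of the two regular characters.       *)
Lemma block_trace z x y : primitive z ->
  ltr (fun a => x * a * y * z) * chiR z = chiR (x * z) * chiR (y * z).
Proof.
case=> [[zC zz] z0 zP].
pose F x y : K^o := ltr (fun a => x * a * y * z).
have F1 v : lin (F^~ v).
  move=> k s t; rewrite /F /ltr scaler_sumr -big_split; apply: eq_bigr => i _.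
  by rewrite !mulrDl -!scalerAl lin_crd.
have F2 u : lin (F u).
  move=> k s t; rewrite /F /ltr scaler_sumr -big_split; apply: eq_bigr => i _.
  by rewrite mulrDr mulrDl -scalerAr -scalerAl lin_crd.
have F2C u s t : F u (s * t) = F u (t * s).
  transitivity (ltr (fun a => u * (a * s) * t * z)).
    by apply: (@eq_ltr K A) => a; rewrite !mulrA.
  rewrite (@ltr_cyc _ _ _ (fun a => a * s) (fun b => u * b * t * z)) //.
  by apply: (@eq_ltr K A) => a; rewrite -!mulrA zC !mulrA.
have F1C v s t : F (s * t) v = F (t * s) v.
  transitivity (ltr (fun a => s * (t * a) * v * z)).
    by apply: (@eq_ltr K A) => a; rewrite !mulrA.
  rewrite (@ltr_cyc _ _ _ (fun a => t * a) (fun b => s * b * v * z)) //.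
  by apply: (@eq_ltr K A) => a; rewrite !mulrA.
have block (f : A -> K^o) : lin f -> (forall s t, f (s * t) = f (t * s)) ->
    (forall s, f (s * z) = f s) -> exists k : K, forall s, f s = k * chiR (s * z).
  move=> fl fC fz; have [c cC cE] := chiR_repr_central fl fC.
  have [k kE] := zP c cC; exists k => s.
  by rewrite -fz fC cE mulrA kE -scalerAl (linZ lin_chiR) zC.
have d0 := chiR_neq0 zz z0.
have [s|k2 k2E] := block (F 1) (F2 1) (F2C 1).
  by apply: (@eq_ltr K A) => a; rewrite -!mulrA zz.
have [s|k1 k1E] := block (F^~ 1) (F1 1) (F1C 1).
  apply: (@eq_ltr K A) => a; rewrite !mulr1 -!mulrA; congr (_ * _).
  by rewrite mulrA zC -mulrA zz.
have F11 : F 1 1 = chiR z.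
  by apply: (@eq_ltr K A) => a; rewrite mul1r mulr1 zC.
have e1 : k1 = 1.
  apply: (mulIf d0); rewrite mul1r -[in RHS]F11.
  by rewrite -[X in chiR X]mul1r; symmetry; exact: k1E.
have [s|k3 k3E] := block (F x) (F2 x) (F2C x).
  by apply: (@eq_ltr K A) => a; rewrite -!mulrA zz.
have : F x 1 = k3 * chiR z by rewrite k3E mul1r.
rewrite k1E e1 mul1r => ->.
rewrite -[ltr _]/(F x y) k3E mulrAC; congr (_ * _).
Qed.

End SemisimpleAlgebra.

(** * Splitting central idempotents into blocks *)

Section Decomposition.
Variables (K : closedFieldType) (charK : [pchar K] =i pred0) (A : falgType K).
Hypothesis ssA : semisimple A.
Implicit Types (a c e h x y z : A).

Local Hint Resolve lin_chiR : linearity.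

Lemma annihilating_poly c : exists2 p : {poly K}, p != 0 & horner_alg c p = 0.
Proof.
pose n := \dim {:A}.
pose P (v : 'rV[K]_n.+1) : A := horner_alg c (rVpoly v).
have Pl : lin P by move=> k u v; rewrite /P linearP linearP /= mulr_algl.
have [|v v0 Pv] := lin_not_inj Pl; first by rewrite [ltnRHS]dimvf /dim /= mul1n.
exists (rVpoly v) => //; apply: contraNneq v0 => e.
by rewrite -(rVpolyK v) e linear0.
Qed.

(** Apply the linear factors of an annihilating polynomial of c to e one at a time; the last nonzero
    product is the eigenvector. *)
Lemma central_eigen e c : central_idem e -> central c -> e != 0 ->
  exists r : K, exists2 y, y != 0 & e * y = y /\ c * y = r *: y.
Proof.
move=> [eC ee] cC e0; have [p p0 pc] := annihilating_poly c.
have [rs pE] := closed_field_poly_normal p.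
have lp : lead_coef p != 0 by rewrite lead_coef_eq0.
pose q (s : seq K) : {poly K} := \prod_(r <- s) ('X - r%:P).
have : horner_alg c (q rs) * e = 0.
  apply/eqP; have /eqP := pc; rewrite pE linearZ /= mulr_algl scaler_eq0 (negPf lp) /=.
  by move/eqP => ->; rewrite mul0r.
elim: rs {pE} => [|r rs IH]; first by rewrite /q big_nil rmorph1 mul1r => /eqP; rewrite (negPf e0).
have [q0 _|q0] := eqVneq (horner_alg c (q rs) * e) 0; first exact: IH.
rewrite {1}/q big_cons rmorphM /= rmorphB /= horner_algX horner_algC => e1.
exists r, (horner_alg c (q rs) * e) => //; split.
  by rewrite eC -mulrA ee.
by apply/eqP; rewrite -subr_eq0 -{2}[_ * e]mul1r scalerAl -mulrBl mulrA e1.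
Qed.

(** Since e y (e - 1) = 0 for every y, the trace form pairs (e - 1) x e to zero with everything.
    Hence x e = e x e = e x. *)
Lemma central_idem_of_ideal (I : {vspace A}) e : is_left_ideal I ->
  (forall x y, x \in I -> x * y \in I) ->
  e \in I -> (forall x, x \in I -> x * e = x) -> central_idem e.
Proof.
move=> Il Ir eI eP.
have ex x : e * x * e = e * x by rewrite eP // Ir.
split=> [x|]; last exact: eP.
rewrite -ex; apply/eqP; rewrite -subr_eq0; apply/eqP.
apply: (chiR_nondeg charK ssA) => y.
have e0 : e * y * (e - 1) = 0 by rewrite mulrBr mulr1 ex subrr.
have -> : e * x * e - x * e = (e - 1) * x * e by rewrite !mulrBl mul1r.
by rewrite -[_ * e * y]mulrA chiRC mulrA e0 mul0r (lin0 (@lin_chiR _ _)).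
Qed.

(** Induction on the rank of e. If a central c is not scalar on e, take an eigenvalue r of c there:
    u = (c - r) e generates a two-sided ideal that is nonzero and annihilates an eigenvector. Its
    central idempotent [e1] therefore splits e into two nonzero parts. *)
Lemma primitive_decomposition e : central_idem e ->
  exists2 s : seq A, \sum_(z <- s) z = e & forall z, z \in s -> primitive z.
Proof.
move=> eP; have [n en _] := chiR_idem (central_idemM eP).
have [m mn] := ubnP n; elim: m e n eP en mn => // m IH e n eP en nm.
have [->|e0] := eqVneq e 0; first by exists [::] => //; rewrite big_nil.
have [eprim|] := classic (primitive e).
  by exists [:: e]; [rewrite big_seq1 | move=> z; rewrite inE => /eqP ->].
move=> nprim; have [c cC ck] : exists2 c, central c & forall k : K, c * e <> k *: e.
  apply: NNPP => nc; apply: nprim; split=> // c cC.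
  by apply: NNPP => nk; apply: nc; exists c => // k ck; apply: nk; exists k.
have [eC ee] := eP.
have [r [y y0 [ey cy]]] := central_eigen eP cC e0.
pose u := (c - r%:A) * e.
have uC : central u.
  move=> x; rewrite /u -mulrA eC mulrA [RHS]mulrA; congr (_ * _).
  by rewrite mulrBl mulrBr cC mulr_algl mulr_algr.
have uy : u * y = 0 by rewrite /u -mulrA ey mulrBl cy mulr_algl subrr.
have u0 : u != 0.
  by rewrite /u mulrBl mulr_algl subr_eq0; apply/eqP/ck.
pose I := limg (linfun (GRing.mul u)).
have IP x : reflect (exists t, x = u * t) (x \in I).
  apply: (iffP memv_imgP) => [[t _ ->]|[t ->]]; exists t; rewrite ?memvf //.
    by rewrite linfunE.
  by rewrite linfunE.
have Il : is_left_ideal I.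
  move=> h x /IP[t ->]; apply/IP; exists (h * t).
  by rewrite mulrA -uC mulrA.
have Ir x t : x \in I -> x * t \in I.
  by move=> /IP[t' ->]; apply/IP; exists (t' * t); rewrite mulrA.
have [e1 e1I e1P] := ideal_idem ssA Il.
have e1C := central_idem_of_ideal Il Ir e1I e1P.
have [t e1E] := IP _ e1I.
have ue : e * u = u by rewrite -uC /u -mulrA ee.
have ee1 : e * e1 = e1 by rewrite e1E mulrA ue.
have e10 : e1 != 0.
  apply: contraNneq u0 => e10; rewrite -(e1P u) ?e10 ?mulr0 //.
  by apply/IP; exists 1; rewrite mulr1.
have e1y : e1 * y = 0 by rewrite e1E uC -mulrA uy mulr0.
pose e2 := e - e1.
have e2C : central_idem e2.
  split=> [x|]; first by rewrite /e2 mulrBl mulrBr eC (central_idemC e1C).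
  rewrite /e2 mulrBl !mulrBr ee ee1 -eC ee1 (central_idemM e1C).
  by rewrite subrr subr0.
have e20 : e2 != 0.
  rewrite /e2 subr_eq0; apply: contraNneq y0 => e12.
  by rewrite -ey e12 e1y.
have [n1 n1E n10] := chiR_idem (central_idemM e1C).
have [n2 n2E n20] := chiR_idem (central_idemM e2C).
have nE : n = (n1 + n2)%N.
  apply/eqP; rewrite -(natr_inj charK) natrD -n1E -n2E -en -(linD (@lin_chiR _ _)).
  by rewrite addrC subrK.
have n1p : (0 < n1)%N by rewrite lt0n; apply: contraNN e10 => /n10/eqP.
have n2p : (0 < n2)%N by rewrite lt0n; apply: contraNN e20 => /n20/eqP.
have [|s1 s1E s1P] := IH e1 n1 e1C n1E; first by rewrite nE in nm; lia.
have [|s2 s2E s2P] := IH e2 n2 e2C n2E; first by rewrite nE in nm; lia.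
exists (s1 ++ s2); first by rewrite big_cat /= s1E s2E addrC subrK.
by move=> z; rewrite mem_cat => /orP[/s1P|/s2P].
Qed.
End Decomposition.

(** * Elements of finite order *)

Lemma prim_root_exists (K : closedFieldType) M :
  [pchar K] =i pred0 -> (0 < M)%N -> exists zeta : K, M.-primitive_root zeta.
Proof.
move=> charK M0; have [rs e] := closed_field_poly_normal ('X^M - 1 : {poly K}).
have lc1 : lead_coef ('X^M - 1 : {poly K}) = 1 by rewrite lead_coefDl ?lead_coefXn ?size_polyXn // size_polyN size_poly1.
rewrite lc1 scale1r in e.
have srs : size rs = M.
  by have := size_XnsubC (1 : K) M0; rewrite e size_prod_XsubC => -[].
have urs : uniq rs.
  rewrite -separable_prod_XsubC -e separable_Xn_sub_1 //.
  by rewrite (natr_inj0 charK) -lt0n.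
have rrs : all M.-unity_root rs.
  by apply/allP => r; rewrite -root_prod_XsubC -e.
have := @has_prim_root _ _ rs M0 rrs urs _; rewrite srs => /(_ (leqnn _)).
by case/hasP => z _ zP; exists z.
Qed.

Lemma prim_root_neq0 (K : fieldType) M (zeta : K) :
  M.-primitive_root zeta -> zeta != 0.
Proof.
move=> zP; apply/eqP => z0; have := prim_expr_order zP.
by rewrite z0 expr0n gtn_eqF ?(prim_order_gt0 zP) // => /eqP; rewrite eq_sym oner_eq0.
Qed.

Lemma prim_root_inv_sum (K : fieldType) M (zeta : K) k :
  M.-primitive_root zeta -> (k < M)%N ->
  \sum_(j < M) (zeta ^+ (j * k))^-1 = M%:R *+ (k == 0%N).
Proof.
move=> zP kM; have M0 := prim_order_gt0 zP.
have [->|k0] := eqVneq k 0%N.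
  under eq_bigr => j _ do rewrite muln0 expr0 invr1.
  by rewrite sumr_const card_ord mulr1n.
rewrite mulr0n; pose w := (zeta ^+ k)^-1.
have w1 : w != 1.
  rewrite /w invr_eq1 -(expr0 zeta) (eq_prim_root_expr zP) mod0n modn_small //.
apply: (mulfI (x := w - 1)); first by rewrite subr_eq0.
rewrite mulr0 -[RHS](subrr 1) -{3}(expr1n _ M) -[X in _ - X]/(1).
transitivity (w ^+ M - 1).
  rewrite subrX1; congr (_ * _); apply: eq_bigr => j _.
  by rewrite /w exprVn -exprM mulnC.
by rewrite /w exprVn exprAC (prim_expr_order zP) !expr1n invr1 subrr.
Qed.

Section FiniteOrder.
Variables (K : fieldType) (charK : [pchar K] =i pred0) (A : falgType K).
Variables (M : nat) (zeta : K).
Hypothesis zetaP : M.-primitive_root zeta.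
Local Hint Resolve lin_chiR : linearity.

(** The [E j] are the spectral projections of v on the part cut out by z, obtained by Fourier
    inversion on its powers; the multiplicity [f j] is the rank of [E j]. *)
Lemma finite_order_character (z v : A) : central_idem z -> v ^+ M * z = z ->
  exists f : nat -> nat, forall k,
    chiR (v ^+ k * z) = \sum_(j < M) (f j)%:R * zeta ^+ (j * k).
Proof.
move=> [zC zz] vM; have M0 := prim_order_gt0 zetaP.
have MK : M%:R != 0 :> K by rewrite (natr_inj0 charK) -lt0n.
have z0 := prim_root_neq0 zetaP.
pose a j k : A := (zeta ^+ (j * k))^-1 *: (v ^+ k * z).
pose E j : A := M%:R^-1 *: \sum_(k < M) a j k.
have vE j : v * E j = zeta ^+ j *: E j.
  rewrite /E -scalerAr scalerA mulrC -scalerA; congr (_ *: _).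
  have aS k : v * a j k = zeta ^+ j *: a j k.+1.
    rewrite /a -scalerAr mulrA -exprS scalerA mulnS exprD invfM mulrA divff ?mul1r //.
    by rewrite expf_neq0.
  rewrite mulr_sumr scaler_sumr.
  apply: (addrI (zeta ^+ j *: a j 0%N)); rewrite addrC.
  have aM : a j M = a j 0%N.
    by rewrite /a vM muln0 expr0 mul1r mulnC exprM (prim_expr_order zetaP) expr1n.
  rewrite (eq_bigr (fun k : 'I_M => zeta ^+ j *: a j k.+1)) => [|k _ //].
  rewrite addrC -(big_ord_recl M (fun k : 'I_M.+1 => zeta ^+ j *: a j k)).
  by rewrite big_ord_recr /= aM addrC.
have vkE k j : v ^+ k * E j = zeta ^+ (j * k) *: E j.
  elim: k => [|k IH]; first by rewrite muln0 !expr0 mul1r scale1r.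
  by rewrite exprSr -mulrA vE -scalerAr IH scalerA -exprD mulnS.
have zE j : z * E j = E j.
  rewrite /E -scalerAr mulr_sumr; congr (_ *: _); apply: eq_bigr => k _.
  by rewrite /a -scalerAr zC -mulrA zz.
have EE j : E j * E j = E j.
  rewrite {1}/E -scalerAl mulr_suml (eq_bigr (fun=> E j)) => [|k _].
    by rewrite sumr_const card_ord -scaler_nat scalerA mulVf ?scale1r.
  rewrite /a -scalerAl -mulrA zE vkE scalerA mulVf ?scale1r //.
  by rewrite expf_neq0.
have sumE : \sum_(j < M) E j = z.
  rewrite /E -scaler_sumr exchange_big /=.
  rewrite (eq_bigr (fun k : 'I_M => (M%:R *+ (k == 0%N :> nat)) *: (v ^+ k * z))); last first.
    move=> k _; rewrite /a -scaler_suml; congr (_ *: _).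
    by rewrite prim_root_inv_sum.
  rewrite (bigD1 (Ordinal M0)) //= expr0 mul1r big1 => [|k k0].
    by rewrite addr0 mulr1n scalerA mulVf // scale1r.
  by rewrite (_ : (k == 0%N :> nat) = false) ?mulr0n ?scale0r //; apply/negbTE.
pose f j := \dim (limg (linfun (GRing.mul (E j)))).
have fE j : chiR (E j) = (f j)%:R.
  by apply: (ltr_idem (lin_mull (E j))) => x; rewrite mulrA EE.
exists f => k; rewrite -{1}sumE mulr_sumr (lin_sum (@lin_chiR _ _)).
by apply: eq_bigr => j _; rewrite vkE (linZ (@lin_chiR _ _)) fE [LHS]mulrC.
Qed.

End FiniteOrder.

(** * Positivity through integer matrices *)

Section Circulant.
Variables (K : fieldType) (charK : [pchar K] =i pred0).

Lemma intr_eq0_char0 (k : int) : (k%:~R == 0 :> K) = (k == 0).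
Proof.
case: k => n; first exact: natr_inj0.
by rewrite NegzE rmorphN /= !oppr_eq0; exact: natr_inj0.
Qed.

Lemma natr_sum1 M (f : 'I_M -> nat) : (\sum_j f j = 1)%N ->
  exists j0, forall j, f j = (j == j0).
Proof.
move=> f1; have [j0 fj0] : exists j0, f j0 != 0%N.
  apply/existsP; rewrite -negb_forall; apply/negP => /forallP f0.
  by move: f1; rewrite big1 // => j _; apply/eqP.
exists j0 => j; move: f1; rewrite (bigD1 j0) //=.
have [-> | jj0] := eqVneq j j0; first by case: (f j0) fj0 => // -[].
rewrite (bigD1 j) //=; case: (f j0) fj0 => // n _.
by case: (f j) => // k; rewrite addSn addnS.
Qed.

(* The sum is an eigenvalue of a symmetric positive definite integer matrix:  *)
(* a combination of the F^T F, for F the circulant matrices of the f t.       *)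
Lemma norm_sum_neq0 M (zeta : K) (T : Type) (s : seq T) (c : T -> nat)
    (f : T -> nat -> nat) t0 :
  (0 < M)%N -> zeta ^+ M = 1 -> (0 < c t0)%N ->
  (\sum_(j < M) f t0 j = 1)%N ->
  \sum_(t <- t0 :: s) (c t)%:R * ((\sum_(j < M) (f t j)%:R * zeta ^+ j) *
    (\sum_(j < M) (f t j)%:R * zeta ^- j)) != 0.
Proof.
case: M => // M _ zM ct0 ft0; set D := \sum_(t <- _) _.
have z0 : zeta != 0.
  by apply/eqP => z0; move: zM; rewrite z0 expr0n => /eqP; rewrite eq_sym oner_eq0.
have zmod k : zeta ^+ (k %% M.+1) = zeta ^+ k.
  by rewrite [in RHS](divn_eq k M.+1) exprD mulnC exprM zM expr1n mul1r.
have zD (i j : 'I_M.+1) : zeta ^+ (i + j)%R = zeta ^+ i * zeta ^+ j.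
  by rewrite /= zmod exprD.
pose F t : 'M[int]_M.+1 := \matrix_(i, j) (f t (j - i)%R)%:Z.
pose C : 'M[int]_M.+1 := \sum_(t <- t0 :: s) (c t)%:Z *: ((F t)^T *m F t).
have detC : \det C != 0.
  apply/det0P => -[v v0 vC].
  pose q t := \sum_i ((v *m (F t)^T) 0 i) ^+ 2.
  have q0 t : 0 <= q t by apply: sumr_ge0 => i _; exact: sqr_ge0.
  have qE : \sum_(t <- t0 :: s) (c t)%:Z * q t = 0.
    transitivity ((v *m C *m v^T) 0 0); last by rewrite vC mul0mx mxE.
    rewrite /C mulmx_sumr mulmx_suml summxE; apply: eq_bigr => t _.
    rewrite -scalemxAr -scalemxAl mxE; congr (_ * _).
    have Fv : F t *m v^T = (v *m (F t)^T)^T by rewrite trmx_mul trmxK.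
    rewrite mulmxA -[_ *m F t *m _]mulmxA Fv mxE.
    by apply: eq_bigr => i _; rewrite expr2 [X in _ = _ * X]mxE.
  have qt0 : q t0 = 0.
    apply/eqP; rewrite eq_le q0 andbT -(@pmulr_rle0 _ (c t0)%:Z) //.
    rewrite -qE big_cons lerDl; apply: sumr_ge0 => t _.
    exact: mulr_ge0.
  (* [f t0] is the indicator of a single index [j0], so [F t0] is a permutation matrix and cannot
     kill a nonzero v. *)
  have [j0 fj0] := natr_sum1 ft0.
  move/eqP: v0; apply; apply/rowP => j.
  have := qt0; rewrite /q => /eqP; rewrite psumr_eq0 => [|i _]; last exact: sqr_ge0.
  move=> /allP/(_ (j - j0)); rewrite mem_index_enum sqrf_eq0 => /(_ isT)/eqP.
  rewrite !mxE => <-; rewrite (bigD1 j) //= !mxE big1 => [|k kj].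
    by rewrite addr0 fj0 subKr eqxx mulr1.
  rewrite !mxE fj0 (_ : (_ == _) = false) ?mulr0 //; apply/negbTE.
  by rewrite subr_eq addrCA subrr addr0.
pose e : 'cV[K]_M.+1 := \col_j zeta ^+ j.
have Fe t : map_mx intr (F t) *m e = (\sum_(j < M.+1) (f t j)%:R * zeta ^+ j) *: e.
  apply/colP => i; rewrite !mxE mulr_suml (reindex_inj (addIr i)) /=.
  by apply: eq_bigr => j _; rewrite !mxE addrK zD mulrA.
have FTe t : map_mx intr (F t)^T *m e = (\sum_(j < M.+1) (f t j)%:R * zeta ^- j) *: e.
  apply/colP => i; rewrite !mxE mulr_suml (reindex_inj (subrI i)) /=.
  apply: eq_bigr => j _; rewrite !mxE subKr -mulrA; congr (_ * _).
  by apply: (mulfI (expf_neq0 j z0)); rewrite mulrA divff ?mul1r ?expf_neq0 // -zD addrC subrK.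
have Ce : map_mx intr C *m e = D *: e.
  rewrite /C raddf_sum mulmx_suml scaler_suml; apply: eq_bigr => t _.
  rewrite /= map_mxZ map_mxM -scalemxAl -mulmxA Fe -scalemxAr FTe !scalerA.
  by rewrite mulrA.
(* If D were 0, then [e] would be a kernel vector of C over K; the determinant is an integer, so
   characteristic zero brings its vanishing back to the integers. *)
apply: contraNneq detC => D0; rewrite -intr_eq0_char0 -det_map_mx.
rewrite -det_tr; apply/det0P; exists e^T.
  apply/eqP => /rowP/(_ 0); rewrite !mxE expr0 => /eqP.
  by rewrite oner_eq0.
by rewrite -trmx_mul Ce D0 scale0r trmx0.
Qed.

End Circulant.

(** Powers of x are grouplike. In the first linear relation among them, comparing coproducts gives
    c_i c_j = 0 for distinct i, j and c_j^2 = c_j, so the relation is just x^d = x^i with i < d. *)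
Lemma grouplike_finite_order (K : fieldType) (H : hopfAlgType K) (x x' : H) :
  (forall f : H -> H -> K^o, lin2 f -> \sw_(a, b <- x) f a b = f x x) ->
  x * x' = 1 -> x' * x = 1 -> exists2 N, (0 < N)%N & x ^+ N = 1.
Proof.
move=> xgl xx' x'x.
have sw_exp k (f : H -> H -> K^o) : lin2 f ->
    \sw_(a, b <- x ^+ k) f a b = f (x ^+ k) (x ^+ k).
  elim: k f => [|k IH] f fl; have [f1 f2] := fl.
    by rewrite expr0 sw1.
  by rewrite exprSr swM // IH // xgl.
have xx'n k : x ^+ k * x' ^+ k = 1.
  elim: k => [|k IH]; first by rewrite !expr0 mulr1.
  by rewrite exprSr exprS mulrA -[_ * x * x']mulrA xx' mulr1.
pose X d : d.-tuple H := map_tuple (GRing.exp x) (iota_tuple d 0).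
have ex : exists d, ~~ free (X d.+1).
  exists (\dim {:H}); rewrite /free size_tuple neq_ltn.
  by rewrite ltnS dimvS // subvf.
have [d dnf dmin] := ex_minnP ex.
have df : free (X d).
  case: d dnf dmin => [|d] _ dmin; first by rewrite (tuple0 (X 0%N)) nil_free.
  by apply: contraT => /dmin; rewrite ltnn.
have xd : x ^+ d \in <<X d>>%VS.
  apply: contraNT dnf => xd.
  rewrite (@perm_free _ _ _ (x ^+ d :: X d)) ?free_cons ?xd //.
  by rewrite -[tval (X d.+1)]/(mkseq (GRing.exp x) d.+1) mkseqS perm_rcons.
pose c i := coord (X d) i (x ^+ d).
have cE (i j : 'I_d) : coord (X d) i (x ^+ j) = (i == j)%:R.
  by have := coord_free j i df; rewrite (nth_mkseq 0 (GRing.exp x)) // eq_sym => ->.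
have xdE : x ^+ d = \sum_(i < d) c i *: x ^+ i.
  rewrite {1}(coord_span xd); apply: eq_bigr => i _.
  by rewrite (nth_mkseq 0 (GRing.exp x)).
have cc i j : c i * c j = c j * (i == j)%:R.
  pose gam k (a : H) : K^o := coord (X d) k a.
  have cl k : lin (gam k) by exact: lin_coord.
  pose f a b : K^o := gam i a * gam j b.
  have fl : lin2 f by rewrite /f.
  have e1 := sw_exp d f fl.
  pose F y : K^o := \sw_(a, b <- y) f a b.
  have Fl : lin F by rewrite /F.
  transitivity (F (x ^+ d)); first by rewrite /F e1.
  rewrite xdE (lin_sum Fl) (bigD1 j) //= big1 => [|k kj].
    rewrite (linZ Fl) /F sw_exp // /f /gam !cE eqxx mulr1 addr0; exact: erefl.
  by rewrite (linZ Fl) /F sw_exp // /f /gam !cE [j == k]eq_sym (negPf kj) mulr0 scaler0.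
have [i ci] : exists i, c i != 0.
  apply/existsP; apply: contraT; rewrite negb_exists => /forallP c0.
  have x0 : x ^+ d = 0.
    by rewrite xdE big1 // => i _; have := c0 i; rewrite negbK => /eqP ->; rewrite scale0r.
  by have /eqP := xx'n d; rewrite x0 mul0r eq_sym oner_eq0.
have ci1 : c i = 1 by apply: (mulfI ci); rewrite cc eqxx.
have xdi : x ^+ d = x ^+ i.
  rewrite xdE (bigD1 i) //= ci1 scale1r big1 ?addr0 // => j ji.
  have := cc i j; rewrite ci1 mul1r [i == j]eq_sym (negPf ji) mulr0 => ->.
  by rewrite scale0r.
exists (d - i)%N; first by rewrite subn_gt0.
have := congr1 (fun y => y * x' ^+ i) xdi; rewrite xx'n.
by rewrite -{1}(subnK (ltnW (ltn_ord i))) exprD -mulrA xx'n mulr1.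
Qed.

(** * The square of the antipode *)

Definition unit_circle_norm (K : fieldType) M (zeta : K) (f : nat -> nat) : K :=
  (\sum_(j < M) (f j)%:R * zeta ^+ j) * (\sum_(j < M) (f j)%:R * zeta ^- j).

Section SquareOfAntipode.
Variables (K : closedFieldType) (charK : [pchar K] =i pred0).
Variables (H : hopfAlgType K) (ssH : semisimple H) (L : H).
Hypothesis hL : is_normalized_integral L.
Implicit Types (h x y z : H).

Local Notation S := (antipode : 'End(H)).
Local Notation eps := (counit : 'Hom(H, K^o)).
Local Notation g := (modular L).

(** [w] represents [lam] through the trace form. As [chiR] is a trace, the Nakayama identity becomes
    w h = S^2(h) w, and nondegeneracy of [lam] makes [w] invertible. *)
Lemma antipode_sqr_inner : exists w w' : H, [/\ w * w' = 1, w' * w = 1 &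
  forall h, S (S h) = w * h * w'].
Proof.
have [w wE] := chiR_repr charK ssH (@lin_lam K H).
have wS h : w * h = S (S h) * w.
  apply/eqP; rewrite -subr_eq0; apply/eqP.
  apply: (chiR_nondeg charK ssH) => y.
  rewrite mulrBl (linB (@lin_chiR _ _)) -!mulrA -wE [chiR (S _ * _)]chiRC.
  by rewrite -mulrA -wE (lam_nakayama hL) subrr.
have winj y : w * y = 0 -> y = 0.
  move=> wy; apply: (antipode_inj hL); apply: (antipode_inj hL); rewrite !linear0.
  apply: (lam_nondeg hL) => x; rewrite -(lam_nakayama hL) wE mulrA wy mul0r.
  exact: (lin0 (@lin_chiR _ _)).
have [w' ww'] := lin_inj_surj (lin_mull w) winj (erefl _) 1.
have w'w : w' * w = 1.
  apply/eqP; rewrite -subr_eq0; apply/eqP; apply: winj.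
  by rewrite mulrBr mulrA ww' mul1r mulr1 subrr.
exists w, w'; split=> // h.
by rewrite wS -mulrA ww' mulr1.
Qed.

Lemma primitive_integral : primitive L.
Proof.
have LC : central L by move=> x; rewrite (integral_left hL) (integral_right hL).
have LL : L * L = L by rewrite (integral_left hL) (integral_counit hL) scale1r.
split=> [||c cC]; first by split.
  apply/eqP => L0; have := integral_counit hL; rewrite L0 linear0 => /eqP.
  by rewrite eq_sym oner_eq0.
by exists (eps c); rewrite (integral_left hL).
Qed.

Lemma chiR_integral : chiR L = 1.
Proof.
rewrite /chiR (@eq_ltr _ _ _ (fun y => (eps y : K) *: L)) => [|y].
  by rewrite ltr_rank1 // (integral_counit hL).
by rewrite (integral_right hL).
Qed.

(** On the block, the central element g w^2 is a scalar k. With s^2 = 1/k, v = s w satisfies v^M = 1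
    there, so its inverse is v^(M-1). Replacing w, w' by v and its inverse does not change w h w',
    and [block_trace] turns the trace into f(zeta) f(1/zeta), with f the eigenvalue multiplicities
    of v. *)
Lemma block_unit_circle_norm M (zeta : K) (w w' z : H) N :
  w * w' = 1 -> w' * w = 1 -> (forall h, S (S h) = w * h * w') ->
  central (g * w * w) -> g ^+ N = 1 ->
  M = (2 * N)%N -> M.-primitive_root zeta -> primitive z ->
  exists f : nat -> nat, chiR z = (\sum_(j < M) f j)%:R /\
    ltr (fun h => w * h * w' * z) * chiR z = unit_circle_norm M zeta f.
Proof.
move=> ww' w'w wS qC gN ME zetaP zP.
have [[zC zz] z0 zs] := zP; have [k kE] := zs _ qC.
pose q' := w' * w' * S g.
have q'q : q' * (g * w * w) = 1.
  rewrite /q' !mulrA -[_ * S g * g]mulrA (mul_antipode_modular hL) mulr1.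
  by rewrite -[w' * w' * w]mulrA w'w mulr1 w'w.
have k0 : k != 0.
  apply: contraNneq z0 => k0; rewrite -[z]mul1r -q'q -mulrA kE k0 scale0r mulr0.
  by [].
have [s s2] : exists s : K, s ^+ 2 = k^-1.
  have [s] := @solve_monicpoly K 2 (fun i => if i == 0%N then k^-1 else 0) isT.
  by rewrite !big_ord_recl big_ord0 /= expr0 mulr1 mul0r !addr0 => ?; exists s.
have s0 : s != 0.
  by apply: contra_eq_neq s2 => ->; rewrite expr0n eq_sym invr_eq0.
pose v := s *: w.
have gw : g * w = w * g.
  by rewrite -{1}(antipode_sqr_modular hL) wS -mulrA w'w mulr1.
have wMz : w ^+ M * z = k ^+ N *: z.
  have -> : w ^+ M = (g * w * w) ^+ N.
    rewrite -mulrA exprMn_comm ?gN ?mul1r -?expr2 -?exprM -?ME //.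
    by apply/commrX.
  elim: (N) => [|n IH]; first by rewrite !expr0 mul1r scale1r.
  by rewrite exprS -mulrA IH -scalerAr kE scalerA exprSr.
have vMz : v ^+ M * z = z.
  by rewrite exprZn -scalerAl wMz scalerA ME exprM s2 -exprMn mulVf // expr1n scale1r.
have M0 := prim_order_gt0 zetaP.
have vMz1 : v ^+ M.-1 * z = s^-1 *: (w' * z).
  have e : z = s *: (w * (v ^+ M.-1 * z)).
    by rewrite -{1}vMz -{1}(prednK M0) exprS -mulrA {1}/v -scalerAl.
  by rewrite {2}e -scalerAr scalerA mulVf // scale1r mulrA w'w mul1r.
have [f fE] := finite_order_character charK zetaP (Build_central_idem zC zz) vMz.
exists f; split.
  have := fE 0%N; rewrite expr0 mul1r => ->; rewrite natr_sum.
  by apply: eq_bigr => j _; rewrite muln0 expr0 mulr1.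
rewrite (block_trace charK ssH _ _ zP) /unit_circle_norm.
transitivity (chiR (v ^+ 1 * z) * chiR (v ^+ M.-1 * z)).
  rewrite expr1 vMz1 /v -scalerAl !(linZ (@lin_chiR _ _)).
  by rewrite /GRing.scale /= mulrACA mulfV // mul1r.
rewrite !fE; congr (_ * _); apply: eq_bigr => j _; first by rewrite muln1.
congr (_ * _); apply: (mulfI (expf_neq0 j (prim_root_neq0 zetaP))).
rewrite divff ?expf_neq0 ?(prim_root_neq0 zetaP) //.
by rewrite -exprD -mulnS (prednK M0) mulnC exprM (prim_expr_order zetaP) expr1n.
Qed.

(** Tr(S^2) is a sum over blocks of norms divided by the ranks [chiR z]. The block of L has rank
    one, which supplies the multiplicity function of total 1 required by [norm_sum_neq0]. *)
Theorem lam1_neq0 : lam (1 : H) != 0.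
Proof.
have [w [w' [ww' w'w wS]]] := antipode_sqr_inner.
have qC : central (g * w * w).
  move=> y; have := antipode4 hL y; rewrite !wS => e.
  have w'wK x : w' * (w * x) = x by rewrite mulrA w'w mul1r.
  by rewrite !mulrA e -!mulrA w'wK w'w mulr1.
have [N N0 gN] : exists2 N, (0 < N)%N & g ^+ N = 1.
  apply: (grouplike_finite_order _ (mul_modular_antipode hL) (mul_antipode_modular hL)).
  by move=> f fl; rewrite (sw_modular hL).
have [|zeta zetaP] := @prim_root_exists K (2 * N) charK; first by rewrite muln_gt0.
set M := (2 * N)%N in zetaP.
have block z := block_unit_circle_norm ww' w'w wS qC gN (erefl M) zetaP (z := z).
have [LI L0 _] := primitive_integral.
have [LC LL] := LI.
have [s sE sP] : exists2 s : seq H, \sum_(z <- s) z = 1 - L & forall z, z \in s -> primitive z.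
  apply: (primitive_decomposition charK ssH); split=> [x|].
    by rewrite mulrBl mulrBr mul1r mulr1 LC.
  by rewrite mulrBl mul1r mulrBr mulr1 LL subrr subr0.
pose T z := ltr (fun h => w * h * w' * z).
have lamE : lam (1 : H) = T L + \sum_(z <- s) T z.
  rewrite /T -ltr_sum -ltrD /lam. apply: (@eq_ltr K H) => h.
  by rewrite mul1r -mulr_sumr sE -mulrDr addrC subrK mulr1 wS.
have [fL [fL1 fLE]] := block L primitive_integral.
rewrite chiR_integral mulr1 in fLE; rewrite chiR_integral in fL1.
(* [B] is the product of the ranks [chiR z]; it clears denominators while the coefficients stay
   natural numbers. *)
have [B B0 [us usE]] : exists2 B, (0 < B)%N & exists us : seq (nat * (nat -> nat)),
    B%:R * (\sum_(z <- s) T z) = \sum_(u <- us) u.1%:R * unit_circle_norm M zeta u.2.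
  elim: s {sE lamE} sP => [|z s IH] sP.
    by exists 1%N => //; exists [::]; rewrite !big_nil mulr0.
  have [|B B0 [us usE]] := IH; first by move=> x xs; apply: sP; rewrite inE xs orbT.
  have [|f [fz fE]] := block z; first by apply: sP; rewrite inE eqxx.
  set d := (\sum_(j < M) f j)%N in fz.
  exists (B * d)%N.
    rewrite muln_gt0 B0 lt0n -(natr_inj0 charK) -fz.
    have [[_ zz] z0 _] : primitive z by apply: sP; rewrite inE eqxx.
    exact: chiR_neq0.
  exists ((B, f) :: [seq ((u.1 * d)%N, u.2) | u <- us]).
  rewrite !big_cons big_map mulrDr; congr (_ + _).
    by rewrite /= -fE natrM -mulrA [d%:R * _]mulrC -fz.
  rewrite natrM mulrAC usE mulr_suml; apply: eq_bigr => u _ /=.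
  by rewrite natrM mulrAC.
have BD : B%:R * lam (1 : H) = \sum_(u <- (B, fL) :: us) u.1%:R * unit_circle_norm M zeta u.2 :> K.
  by rewrite big_cons lamE mulrDr usE -fLE.
have : B%:R * lam (1 : H) != 0 :> K.
  rewrite BD; apply: (norm_sum_neq0 charK us (t0 := (B, fL)) (c := fst) (f := snd)).
  - exact: prim_order_gt0 zetaP.
  - exact: prim_expr_order.
  - exact: B0.
  - apply/eqP; rewrite -(natr_inj charK) -fL1; exact: eqxx.
by apply: contraNneq => ->; rewrite mulr0.
Qed.
End SquareOfAntipode.

(** * Involutivity of S, and the regular character of the dual *)

Section Involutive.
Variables (K : closedFieldType) (charK : [pchar K] =i pred0).
Variables (H : hopfAlgType K) (ssH : semisimple H) (L : H).
Hypothesis hL : is_normalized_integral L.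
Implicit Types (h x y z : H).

Local Notation S := (antipode : 'End(H)).
Local Notation eps := (counit : 'Hom(H, K^o)).
Local Notation n := (\dim {:H}).

(** At 1, [sw_lam] reads lam(1) 1 = lam(1) g. *)
Lemma modular_eq1 : modular L = 1.
Proof.
have := sw_lam hL 1; rewrite sw1 // => /eqP; rewrite eq_sym -subr_eq0 -scalerBr.
rewrite scaler_eq0 (negPf (lam1_neq0 charK ssH hL)) /= subr_eq0.
by move/eqP.
Qed.

Lemma antipode4_id y : S (S (S (S y))) = y.
Proof. by have := antipode4 hL y; rewrite modular_eq1 mulr1 mul1r. Qed.

(* The regular character of the dual algebra. *)
Definition dual_chi : H :=
  \sum_i \sw_(a, b <- bas i) ((crd i a : K) *: b).

Lemma dual_chiE (phi : H -> K^o) : lin phi ->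
  phi dual_chi = ltr (fun y => \sw_(a, b <- y) ((phi b : K) *: a)).
Proof.
move=> phil; rewrite (lin_sum phil); apply: eq_bigr => i _.
rewrite (lin_tlift_pull _ _ phil) (lin_tlift_pull _ _ (@lin_crd _ _ i)).
apply: eq_tlift => a b; rewrite (linZ phil) (linZ (@lin_crd _ _ i)).
exact: mulrC.
Qed.

Lemma lam_dual_chi : lam dual_chi = lam (1 : H).
Proof.
rewrite (dual_chiE (@lin_lam _ _)).
rewrite (@eq_ltr _ _ _ (fun y => (lam y : K) *: 1)) => [|y].
  by rewrite ltr_rank1 //; exact: lin_lam.
exact: (lam_left_invariant _).2.
Qed.

Lemma counit_dual_chi : eps dual_chi = n%:R.
Proof.
rewrite (dual_chiE (@lin_lfun _ _ _ _)) -ltr_id; apply: (@eq_ltr K H) => y.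
exact: counitr.
Qed.

(** A regular character is a trace function; for the dual algebra this is cocommutativity of t.
    [X k] and [Y k] are the translations that cyclicity interchanges. *)
Lemma sw_dual_chiC (f : H -> H -> K^o) : lin2 f ->
  \sw_(a, b <- dual_chi) f a b = \sw_(a, b <- dual_chi) f b a.
Proof.
case=> f1 f2.
have crdl k : lin (@crd K H k) by exact: lin_crd.
have fl1 : lin (fun x => \sw_(a, b <- x) f a b) by [].
have fl2 : lin (fun x => \sw_(a, b <- x) f b a) by [].
rewrite (dual_chiE fl1) (dual_chiE fl2).
have fsum c d : \sum_k (crd k c : K) *: f (bas k) d = f c d.
  rewrite [in RHS](basE c) (lin_sum (f1 d)); apply: eq_bigr => k _.
  by rewrite (linZ (f1 d)).
pose Y k y := \sw_(z, d <- y) ((f (bas k) d : K) *: z).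
pose X k y := \sw_(a, c <- y) ((crd k c : K) *: a).
have Yl k : lin (Y k) by rewrite /Y.
have Xl k : lin (X k) by rewrite /X.
transitivity (ltr (fun y => \sum_k X k (Y k y))).
  apply: (@eq_ltr K H) => y.
  transitivity (\sw_(a, b <- y) \sw_(c, d <- b) ((f c d : K) *: a)).
    by apply: eq_tlift => a b; rewrite (lin_tlift_pull _ _ (@lin_scaler _ _ a)).
  rewrite swA //.
  transitivity (\sum_k \sw_(z, d <- y) \sw_(a, c <- z)
     (((crd k c *: f (bas k) d) : K) *: a)).
    rewrite -tlift_bigsum; apply: eq_tlift => z d.
    rewrite -tlift_bigsum; apply: eq_tlift => a c.
    by rewrite -scaler_suml fsum.
  apply: eq_bigr => k _; rewrite /Y (lin_tlift_pull _ _ (Xl k)).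
  apply: eq_tlift => z d; rewrite (linZ (Xl k)) /X.
  rewrite (lin_tlift_pull _ _ (@lin_scale _ _ _)).
  by apply: eq_tlift => a c; rewrite scalerA mulrC.
rewrite ltr_sum; under eq_bigr => k _ do rewrite (ltr_cyc (Yl k) (Xl k)).
rewrite -ltr_sum; apply: (@eq_ltr K H) => y.
transitivity (\sw_(a, b <- y) \sw_(d, c <- b) ((f c d : K) *: a)); last first.
  by apply: eq_tlift => a b; rewrite (lin_tlift_pull _ _ (@lin_scaler _ _ a)).
rewrite swA //.
transitivity (\sum_k \sw_(a, c <- y) \sw_(z, d <- a)
   (((crd k c *: f (bas k) d) : K) *: z)); last first.
  rewrite -tlift_bigsum; apply: eq_tlift => a c.
  rewrite -tlift_bigsum; apply: eq_tlift => z d.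
  by rewrite -scaler_suml fsum.
apply: eq_bigr => k _; rewrite /X (lin_tlift_pull _ _ (Yl k)).
apply: eq_tlift => a c; rewrite (linZ (Yl k)) /Y.
rewrite (lin_tlift_pull _ _ (@lin_scale _ _ _)).
by apply: eq_tlift => z d; rewrite scalerA.
Qed.

(** Inserting S(h_(1)) h_(2) into the trace that computes phi(h t), cyclicity carries S(h_(1)) round
    to form h_(2) S(h_(1)). The hypothesis is met by t itself, by cocommutativity, and by every h
    once S^2 = id. *)
Lemma mul_dual_chi h (k : K) :
  \sw_(a, b <- h) (b * S a) = k *: 1 -> h * dual_chi = k *: dual_chi.
Proof.
move=> hk; apply: functional_ext => phi phil.
have phihl : lin (fun x => phi (h * x)) by [].
rewrite (linZ phil) (dual_chiE phil) (dual_chiE phihl).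
pose P y := \sw_(a, b <- y) ((phi b : K) *: a).
have Pl : lin P by rewrite /P.
transitivity (ltr (fun y => \sw_(h1, h2 <- h) (S h1 * P (h2 * y)))).
  apply: (@eq_ltr K H) => y.
  transitivity (\sw_(h1, h' <- h) \sw_(h2, h3 <- h') \sw_(a, b <- y)
     ((phi (h3 * b) : K) *: (S h1 * h2 * a))); last first.
    apply: eq_tlift => h1 h'; rewrite /P swM //.
    rewrite (lin_tlift_pull _ _ (@lin_mull _ _ (S h1))); apply: eq_tlift => h2 h3.
    rewrite (lin_tlift_pull _ _ (@lin_mull _ _ (S h1))); apply: eq_tlift => a b.
    by rewrite -scalerAr mulrA.
  rewrite swA //.
  transitivity (\sw_(d, h3 <- h) ((eps d : K) *:
     \sw_(a, b <- y) ((phi (h3 * b) : K) *: a))); first by rewrite sw_counitl.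
  apply: eq_tlift => d h3.
  rewrite (@sw_antipodel _ _ _ (fun u => \sw_(a, b <- y) ((phi (h3 * b) : K) *: (u * a)))) //.
  by congr (_ *: _); apply: eq_tlift => a b; rewrite mul1r.
transitivity (ltr (fun y => P (k *: 1 * y))); last first.
  rewrite -[RHS]/(k * _) -ltrZ; apply: (@eq_ltr K H) => y.
  by rewrite mulr_algl (linZ Pl).
rewrite ltr_tlift.
transitivity (\sw_(a, b <- h) (ltr (fun y => P (b * S a * y)) : K^o)).
  apply: eq_tlift => a b.
  rewrite (@ltr_cyc _ _ _ (fun y => P (b * y)) (fun y => S a * y)) //.
  by apply: (@eq_ltr K H) => y; rewrite mulrA.
rewrite -ltr_tlift; apply: (@eq_ltr K H) => y.
have Pyl : lin (fun u => P (u * y)) by [].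
by rewrite -hk (lin_tlift_pull _ _ Pyl).
Qed.

Lemma dual_chi_sqr : dual_chi * dual_chi = n%:R *: dual_chi.
Proof.
apply: mul_dual_chi; rewrite -counit_dual_chi -antipoder.
apply: functional_ext => phi phil; rewrite !(lin_tlift_pull _ _ phil).
by rewrite [RHS]sw_dual_chiC.
Qed.

(** Conjugation by S^2, already an involution, carries the traced operator of phi to that of phi
    after S^2. *)
Lemma antipode_sqr_dual_chi : S (S dual_chi) = dual_chi.
Proof.
apply: functional_ext => phi phil.
have phiSl : lin (fun x => phi (S (S x))) by [].
rewrite (dual_chiE phil) (dual_chiE phiSl).
pose P y := \sw_(a, b <- y) ((phi b : K) *: a).
have Pl : lin P by rewrite /P.
transitivity (ltr (fun y => S (S (P (S (S y)))))).
  apply: (@eq_ltr K H) => y; rewrite /P !sw_antipode //.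
  rewrite !(lin_tlift_pull _ _ (@lin_lfun _ _ _ S)); apply: eq_tlift => a b.
  by rewrite !(linZ (@lin_lfun _ _ _ _)) antipode4_id.
rewrite (@ltr_cyc _ _ _ (fun y => P (S (S y))) (fun y => S (S y))) //.
by apply: (@eq_ltr K H) => y; rewrite antipode4_id.
Qed.

Theorem antipode_sqr y : S (S y) = y.
Proof.
have n0 : (0 < n)%N.
  rewrite lt0n dimv_eq0; apply/negP => /eqP e.
  by have := memvf (1 : H); rewrite e memv0 oner_eq0.
have nK : n%:R != 0 :> K by rewrite (natr_inj0 charK) -lt0n.
have two : 2%:R != 0 :> K by rewrite (natr_inj0 charK).
pose p y := n%:R^-1 *: (dual_chi * y).
have pl : lin p by rewrite /p.
have pp x : p (p x) = p x.
  rewrite /p -scalerAr mulrA dual_chi_sqr -scalerAl.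
  by rewrite [n%:R^-1 *: (n%:R *: _)]scalerA mulVf // scale1r.
have pS x : p (S (S x)) = S (S (p x)).
  by rewrite /p !(linZ (@lin_lfun _ _ _ _)) !antipodeM antipode_sqr_dual_chi.
pose ep x := 2%:R^-1 *: (x + S (S x)).
pose em x := 2%:R^-1 *: (x - S (S x)).
have epl : lin ep by rewrite /ep.
have eml : lin em by rewrite /em.
have half x : 2%:R^-1 *: (x + x) = x :> H.
  by rewrite -mulr2n -scaler_nat scalerA mulVf // scale1r.
have epS x : S (S (ep x)) = ep x.
  by rewrite /ep !(linZ (@lin_lfun _ _ _ _)) !linearD /= antipode4_id addrC.
have emS x : S (S (em x)) = - em x.
  by rewrite /em !(linZ (@lin_lfun _ _ _ _)) !(linB (@lin_lfun _ _ _ S)) antipode4_id -scalerN opprB.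
have epep x : ep (ep x) = ep x by rewrite {1}/ep epS half.
have emem x : em (em x) = em x by rewrite {1}/em emS opprK half.
have pep x : p (ep x) = ep (p x).
  by rewrite /ep (linZ pl) (linD pl) pS.
have pem x : p (em x) = em (p x).
  by rewrite /em (linZ pl) (linB pl) pS.
have sumE x : ep x + em x = x.
  by rewrite -scalerDr addrACA subrr addr0 half.
have subE x : ep x - em x = S (S x).
  by rewrite -scalerBr opprB [x + _]addrC addrACA subrr addr0 half.
have rank (e : H -> H) : lin e -> (forall x, e (e x) = e x) ->
    exists2 r : nat, ltr e = r%:R & r = 0%N -> forall x, e x = 0.
  move=> el ee; exists (\dim (limg (linfun e))); first exact: ltr_idem.
  move/eqP; rewrite dimv_eq0 => /eqP l0 x.
  by apply/eqP; rewrite -memv0 -l0 -(linfunE el) memv_img // memvf.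
have [r rE r0] := rank _ epl epep.
have [s sE s0] := rank _ eml emem.
(* a and b are the ranks of [p] on the eigenspaces of S^2 for 1 and -1, whose dimensions are r and
   s. *)
have [||a aE _] := rank (fun x => p (ep x)) => [//|x|].
  by rewrite -pep pp epep.
have [||b bE _] := rank (fun x => p (em x)) => [//|x|].
  by rewrite -pem pp emem.
have rs : n = (r + s)%N.
  apply/eqP; rewrite -(natr_inj charK) natrD -rE -sE -ltrD -ltr_id.
  by apply/eqP/(@eq_ltr K H) => x; rewrite sumE.
have DE : lam (1 : H) = r%:R - s%:R.
  rewrite -rE -sE -ltrN -ltrD; apply: (@eq_ltr K H) => x.
  by rewrite mul1r subE.
(* lam(1) = lam(t) = Tr(L_t S^2), which is n times the trace of [p] after S^2. *)
have Dab : lam (1 : H) = n%:R * (a%:R - b%:R).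
  apply: (mulfI (invr_neq0 nK)); rewrite mulrA mulVf // mul1r.
  rewrite -lam_dual_chi -aE -bE -ltrN -ltrD -ltrZ; apply: (@eq_ltr K H) => x.
  by rewrite -(linB pl) subE /p scalerAr.
have rsab : (r + n * b = s + n * a)%N.
  apply/eqP; rewrite -(natr_inj charK) !natrD !natrM.
  rewrite -subr_eq0 opprD addrACA -mulrBr -[b%:R - _]opprB mulrN.
  by rewrite -DE -Dab subrr.
have rs0 : r != s.
  apply: contra_neq (lam1_neq0 charK ssH hL) => e.
  by rewrite DE e subrr.
have rn0 : r != 0%N.
  apply/eqP => /r0/(_ 1); rewrite /ep !antipode1 half => /eqP.
  by rewrite oner_eq0.
(* n divides the nonzero r - s while r + s = n, so r or s is 0; r is not, because S^2 fixes 1. *)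
have s00 : s = 0%N.
  case: (ltngtP a b) => ab.
  - suff : (r == 0)%N by rewrite (negPf rn0).
    by nia.
  - by nia.
  - by move: rs0; rewrite ab in rsab; nia.
by rewrite -subE (s0 s00) subr0 -[RHS]sumE (s0 s00) addr0.
Qed.

(** With S^2 = id, h_(2) S(h_(1)) = eps(h) 1 for every h, so t is a left integral. Then compute L t
    in two ways. *)
Theorem dual_chi_integral : dual_chi = n%:R *: L.
Proof.
have hd h : h * dual_chi = (eps h : K) *: dual_chi.
  apply: mul_dual_chi; rewrite -[in RHS]antipode1.
  rewrite -(@sw_antipoder _ _ _ (fun x => S x)) //; apply: eq_tlift => a b.
  by rewrite antipodeM antipode_sqr.
have := hd L; rewrite (integral_right hL) (integral_counit hL) scale1r => <-.
by rewrite counit_dual_chi.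
Qed.

Theorem ltr_coaction (phi : H -> K^o) : lin phi ->
  ltr (fun y => \sw_(a, b <- y) ((phi b : K) *: a)) = n%:R * phi L.
Proof. by move=> phil; rewrite -dual_chiE // dual_chi_integral (linZ phil). Qed.

End Involutive.

(** * The Drinfel'd double and its induced modules *)

Section Double.
Variables (K : fieldType) (H : hopfAlgType K).
Implicit Types (h g : H) (phi psi : Defs.dual H) (x y : Defs.double H) (W : vectType K).

Local Notation S := (antipode : 'End(H)).
Local Notation eps := (counit : 'Hom(H, K^o)).
Local Notation T := (antipodeV H).
Local Notation "phi # h" := ((phi : 'Hom(H, K^o)) h) (at level 10).

Lemma tlift_tensK (U V : vectType K) (t : tensor U V) :
  tlift (fun u v => tens u v) t = t.
Proof.
apply/matrixP => i j; rewrite /tlift summxE (bigD1 i) //= summxE (bigD1 j) //=.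
rewrite !mxE !coord_free ?(basis_free (vbasisP _)) // !eqxx !mulr1.
rewrite big1 => [|k kj]; last first.
  rewrite !mxE !coord_free ?(basis_free (vbasisP _)) // (negPf kj).
  by rewrite !mulr0.
rewrite addr0 big1 ?addr0 // => k ki; rewrite summxE big1 // => l _.
rewrite !mxE !coord_free ?(basis_free (vbasisP _)) // (negPf ki).
by rewrite mul0r mulr0.
Qed.

Lemma dual_basisE i h : (dual_basis i : Defs.dual H) # h = crd i h.
Proof. exact: (@linfunE K H K^o (crd i) (@lin_crd _ _ i) h). Qed.

(* [phi (x) h] acts as the map [g |-> phi(g) h]; this identifies D(H) with    *)
(* the space of endomorphisms of H.                                           *)
Definition ev x g : H := tlift (fun phi h => (phi # g : K) *: h) x.

Lemma lin_dual_eval h : lin (fun phi : Defs.dual H => phi # h).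
Proof. exact: lin_eval. Qed.
Local Hint Resolve lin_dual_eval : linearity.

Lemma lin_ev g : lin (ev^~ g).
Proof. exact: lin_tliftr. Qed.

Lemma lin_evr x : lin (ev x).
Proof. by rewrite /ev. Qed.
Local Hint Resolve lin_ev lin_evr : linearity.

Lemma ev_tens phi h g : ev (tens phi h) g = (phi # g : K) *: h.
Proof. by rewrite /ev tliftE. Qed.

Lemma evK x : x = \sum_i tens (dual_basis i : Defs.dual H) (ev x (bas i)).
Proof.
rewrite -[LHS]tlift_tensK /ev.
under [RHS]eq_bigr => i _ do rewrite (lin_tlift_pull _ _ (@lin_tensr _ _ _ _)).
rewrite -tlift_bigsum; apply: eq_tlift => phi h.
have -> : phi = \sum_i (phi # (bas i) : K) *: (dual_basis i : Defs.dual H).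
  apply/lfunP => g; rewrite sum_lfunE {1}(basE g) linear_sum /=.
  apply: eq_bigr => i _; rewrite linearZ scale_lfunE dual_basisE; exact: mulrC.
rewrite (lin_sum (@lin_tensl _ _ _ h)); apply: eq_bigr => i _.
rewrite (linZ (@lin_tensl _ _ _ h)) (linZ (@lin_tensr _ _ _ _)); congr (_ *: _).
rewrite sum_lfunE (bigD1 i) //= big1 => [|j ji]; last first.
  by rewrite scale_lfunE dual_basisE crd_bas (negPf ji) scaler0.
by rewrite scale_lfunE dual_basisE crd_bas eqxx addr0 [RHS]mulr1.
Qed.

Lemma dual_sweedler3E psi a b c :
  dual_sweedler3 (fun p1 p2 p3 => p1 # a * (p2 # b * p3 # c) : K^o) psi =
  psi # (a * (b * c)).
Proof.
rewrite dual_comulE /dual_sweedler3; apply: eq_tlift => p1 p'.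
rewrite dual_comulE; symmetry.
exact: (@lin_tlift_pull K _ _ K^o K^o (fun z => p1 # a * z) _ _ (@lin_kmull _ _)).
Qed.

(** The three factors of psi become one evaluation of psi on a product ([dual_sweedler3E]), so no
    dual coproduct is left. Later computations in D(H) start from this formula. *)
Lemma ev_mul x y g :
  ev (double_mul x y) g =
  \sw_(g1, g2 <- g) \sw_(h1, h' <- ev x g1) \sw_(h2, h3 <- h')
    (h2 * ev y (T h3 * (g2 * h1))).
Proof.
pose R g2 h := \sw_(h1, h' <- h) \sw_(h2, h3 <- h') (h2 * ev y (T h3 * (g2 * h1))).
transitivity (tlift (fun phi h => \sw_(g1, g2 <- g) ((phi # g1 : K) *: R g2 h)) x);
  last first.
  rewrite exchange_tlift; apply: eq_tlift => g1 g2.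
  have Rl : lin (R g2) by rewrite /R.
  rewrite /ev -/(R g2 _) (lin_tlift_pull _ _ Rl).
  by apply: eq_tlift => phi h; rewrite (linZ Rl).
rewrite /double_mul (lin_tlift_pull _ _ (lin_ev g)); apply: eq_tlift => phi h.
rewrite (lin_tlift_pull _ _ (lin_ev g)).
transitivity (\sw_(g1, g2 <- g) tlift (fun psi k => \sw_(h1, h' <- h)
   \sw_(h2, h3 <- h') (((phi # g1 * psi # (T h3 * (g2 * h1)) : K^o) : K) *:
   (h2 * k))) y); last first.
  apply: eq_tlift => g1 g2; rewrite exchange_tlift /R.
  rewrite (lin_tlift_pull _ _ (@lin_scale _ _ _)); apply: eq_tlift => h1 h'.
  rewrite (lin_tlift_pull _ _ (@lin_scale _ _ _)) exchange_tlift.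
  apply: eq_tlift => h2 h3; rewrite /ev (lin_tlift_pull _ _ (@lin_mull _ _ _)).
  rewrite (lin_tlift_pull _ _ (@lin_scale _ _ _)); apply: eq_tlift => psi k.
  by rewrite -scalerAr scalerA.
rewrite exchange_tlift; apply: eq_tlift => psi k.
rewrite /double_mul_pure /sweedler3 (lin_tlift_pull _ _ (lin_ev g)).
rewrite exchange_tlift; apply: eq_tlift => h1 h'.
rewrite (lin_tlift_pull _ _ (lin_ev g)) exchange_tlift; apply: eq_tlift => h2 h3.
rewrite /dual_sweedler3 (lin_tlift_pull _ _ (lin_ev g)).
transitivity (\sw_(g1, g2 <- g) (((phi # g1 * dual_sweedler3 (fun p1 p2 p3 =>
   p1 # (T h3) * (p2 # g2 * p3 # h1) : K^o) psi : K^o) : K) *: (h2 * k))); last first.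
  by apply: eq_tlift => g1 g2; rewrite dual_sweedler3E.
pose B (a c d : Defs.dual H) (g1 g2 : H) : K^o :=
  phi # g1 * (a # (T h3) * (c # g2 * d # h1)).
transitivity (tlift (fun a b => tlift (fun c d => \sw_(g1, g2 <- g)
  ((B a c d g1 g2 : K) *: (h2 * k))) (dual_comul b)) (dual_comul psi)); last first.
  rewrite [LHS](_ : _ = tlift (fun a b => \sw_(g1, g2 <- g) tlift (fun c d =>
    (B a c d g1 g2 : K) *: (h2 * k)) (dual_comul b)) (dual_comul psi)); last first.
    by apply: eq_tlift => a b; rewrite exchange_tlift.
  rewrite exchange_tlift; apply: eq_tlift => g1 g2.
  rewrite /dual_sweedler3 (@lin_tlift_pull _ _ _ K^o _ (fun z : K^o =>
    ((phi # g1 * z : K^o) : K) *: (h2 * k))) //.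
  apply: eq_tlift => a b; rewrite (@lin_tlift_pull _ _ _ K^o _ (fun z : K^o =>
    ((phi # g1 * z : K^o) : K) *: (h2 * k))) //.
apply: eq_tlift => a b; rewrite (lin_tlift_pull _ _ (lin_ev g)).
apply: eq_tlift => c d; rewrite (linZ (lin_ev g)) ev_tens dual_mulE.
rewrite (@lin_tlift_pull _ _ _ K^o _ (fun z : K^o => (z : K) *: (h2 * k))) //.
rewrite (lin_tlift_pull _ _ (@lin_scale _ _ _)); apply: eq_tlift => g1 g2.
rewrite scalerA /B; congr (_ *: _).
have mulE (p q r s : K) : p * s * (q * r) = q * (p * (r * s)).
  by rewrite mulrACA [p * q]mulrC -mulrA [s * r]mulrC.
exact: mulE.
Qed.
End Double.

(** * The induced module as a space of maps *)

Section Induced.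
Variables (K : fieldType) (H : hopfAlgType K) (L : H).
Hypothesis hL : is_normalized_integral L.
Variables (V : vectType K) (rho : 'Hom(H, 'End(V))).
Hypothesis hrho : is_module rho.
Implicit Types (h g : H) (phi psi : Defs.dual H) (x y : Defs.double H).

Local Notation S := (antipode : 'End(H)).
Local Notation eps := (counit : 'Hom(H, K^o)).
Local Notation T := (antipodeV H).
Local Notation "phi # h" := ((phi : 'Hom(H, K^o)) h) (at level 10).
Local Hint Resolve lin_ev lin_evr lin_dual_eval : linearity.

Lemma ev_double_of h g : ev (double_of h) g = (eps g : K) *: h.
Proof. by rewrite ev_tens. Qed.

Lemma counit_antipodeV h : eps (T h) = eps h.
Proof. by rewrite -[in RHS](antipodeVK hL h) counit_antipode. Qed.

(** The dual part of [double_of h] is the counit, which collapses all legs but one. This makes the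
    relations of the induced module pointwise. *)
Lemma ev_mul_double_of x h g : ev (double_mul x (double_of h)) g = ev x g * h.
Proof.
rewrite ev_mul.
transitivity (\sw_(g1, g2 <- g) ((eps g2 : K) *: (ev x g1 * h))); last first.
  by rewrite (@sw_counitr _ _ _ (fun a => ev x a * h)).
apply: eq_tlift => g1 g2.
transitivity (\sw_(h1, h' <- ev x g1) ((eps h1 : K) *: ((eps g2 : K) *: (h' * h)))); last first.
  by rewrite (@sw_counitl _ _ _ (fun a => (eps g2 : K) *: (a * h))).
apply: eq_tlift => h1 h'.
transitivity (\sw_(h2, h3 <- h') ((eps h3 : K) *: ((eps h1 : K) *: ((eps g2 : K) *: (h2 * h))))); last first.
  by rewrite (@sw_counitr _ _ _ (fun a => (eps h1 : K) *: ((eps g2 : K) *: (a * h)))).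
apply: eq_tlift => h2 h3; rewrite ev_double_of -scalerAr !scalerA; congr (_ *: _).
rewrite !counitM counit_antipodeV.
have mulE (p q r : K) : p * (q * r) = p * r * q by rewrite mulrA mulrAC.
exact: mulE.
Qed.

Lemma ev_inj x y : ev x =1 ev y -> x = y.
Proof.
by move=> e; rewrite (evK x) (evK y); apply: eq_bigr => i _; rewrite e.
Qed.

Lemma tens_double_mul phi h :
  tens phi h = double_mul (tens phi 1) (double_of h) :> Defs.double H.
Proof.
by apply: ev_inj => g; rewrite ev_mul_double_of !ev_tens -scalerAl mul1r.
Qed.

(* D(H) (x)_H V is identified with the space of maps H -> V. *)
Definition ind_eval (w : tensor (Defs.double H) V) (g : H) : V :=
  tlift (fun x v => rho (ev x g) v) w.

Definition ind_act x (F : H -> V) (g : H) : V :=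
  \sw_(g1, g2 <- g) \sw_(h1, h' <- ev x g1) \sw_(h2, h3 <- h')
    rho h2 (F (T h3 * (g2 * h1))).

(** [ind_act] is the formula of [ev_mul] with the second factor replaced by F and multiplication by
    the action of H on V. *)
Lemma eq_ind_act x (F F' : H -> V) : F =1 F' -> ind_act x F =1 ind_act x F'.
Proof.
move=> e g; apply: eq_tlift => g1 g2; apply: eq_tlift => h1 h'.
by apply: eq_tlift => h2 h3; rewrite e.
Qed.

Lemma lin_rho_eval v : lin (fun h => rho h v).
Proof. by lin. Qed.

Lemma lin_ind_eval g : lin (ind_eval^~ g).
Proof. exact: lin_tliftr. Qed.

Lemma ind_eval_tens x v g : ind_eval (tens x v) g = rho (ev x g) v.
Proof. by rewrite /ind_eval tliftE. Qed.

Lemma ind_eval_lmul x w g :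
  ind_eval (double_lmul V x w) g = ind_act x (ind_eval w) g.
Proof.
rewrite /double_lmul linfunE; last exact: lin_tliftr.
rewrite (lin_tlift_pull _ _ (lin_ind_eval g)).
transitivity (tlift (fun y v => \sw_(g1, g2 <- g) \sw_(h1, h' <- ev x g1)
  \sw_(h2, h3 <- h') rho h2 (rho (ev y (T h3 * (g2 * h1))) v)) w).
  apply: eq_tlift => y v; rewrite ind_eval_tens ev_mul.
  rewrite (lin_tlift_pull _ _ (lin_rho_eval v)); apply: eq_tlift => g1 g2.
  rewrite (lin_tlift_pull _ _ (lin_rho_eval v)); apply: eq_tlift => h1 h'.
  rewrite (lin_tlift_pull _ _ (lin_rho_eval v)); apply: eq_tlift => h2 h3.
  by rewrite (module_actM hrho) comp_lfunE.
rewrite exchange_tlift; apply: eq_tlift => g1 g2.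
rewrite exchange_tlift; apply: eq_tlift => h1 h'.
rewrite exchange_tlift; apply: eq_tlift => h2 h3.
by rewrite /ind_eval (lin_tlift_pull _ _ (@lin_lfun _ _ _ _)).
Qed.

Lemma ind_eval_rel w g : w \in induced_rel rho -> ind_eval w g = 0.
Proof.
case/memv_imgP => t _ ->; rewrite linfunE; last exact: lin_tliftr.
have tlift0 (A B C : vectType K) (s : tensor A B) : tlift (fun a b => 0 : C) s = 0.
  by rewrite /tlift big1 // => i _; rewrite big1 // => j _; rewrite scaler0.
rewrite /induced_rel_map (lin_tlift_pull _ _ (lin_ind_eval g)) -[RHS](tlift0 _ _ _ t).
apply: eq_tlift => s v.
rewrite (lin_tlift_pull _ _ (lin_ind_eval g)) -[RHS](tlift0 _ _ _ s).
apply: eq_tlift => x h; rewrite (linB (lin_ind_eval g)) !ind_eval_tens.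
by rewrite ev_mul_double_of (module_actM hrho) comp_lfunE subrr.
Qed.

Local Notation q := (quotv_proj (induced_rel rho)).
Local Notation s := (quotv_sect (induced_rel rho)).

Lemma ind_eval_sect w g : ind_eval (s (q w)) g = ind_eval w g.
Proof.
apply/eqP; rewrite -subr_eq0 -(linB (lin_ind_eval g)); apply/eqP.
apply: ind_eval_rel; have : s (q w) - w \in lker q.
  by rewrite memv_ker (linB (@lin_lfun _ _ _ q)) quotv_sectK subrr.
by rewrite lker_quotv_proj.
Qed.

Lemma quotv_proj_mul x h v :
  q (tens (double_mul x (double_of h)) v) = q (tens x (rho h v)).
Proof.
apply/eqP; rewrite -subr_eq0 -linearB -memv_ker lker_quotv_proj.
apply/memv_imgP; exists (tens (tens x h) v); first exact: memvf.
rewrite linfunE; last exact: lin_tliftr.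
pose G x h v : tensor (Defs.double H) V :=
  tens (double_mul x (double_of h)) v - tens x (rho h v).
have dml h' : lin (fun x => double_mul x (double_of h')) by exact: lin_tliftr.
have dmr y : lin (fun h => double_mul y (double_of h)).
  move=> k a b; apply: ev_inj => g; rewrite (lin_ev g) !ev_mul_double_of.
  by rewrite mulrDr scalerAr.
have Gl : lin3 G by rewrite /G.
have [G1 G2 G3] := Gl.
by rewrite /induced_rel_map tliftE // tliftE.
Qed.

Lemma quotv_proj_tens phi h v :
  q (tens (tens phi h : Defs.double H) v) =
  q (tens (tens phi 1 : Defs.double H) (rho h v)).
Proof. by rewrite -quotv_proj_mul -tens_double_mul. Qed.

(** Modulo the relations the H-part of D(H) moves across to V, leaving a combination of generators
    whose coefficients are the values of the associated map. *)
Lemma quotv_projE w :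
  q w = q (\sum_i tens (tens (dual_basis i : Defs.dual H) (1 : H) : Defs.double H)
     (ind_eval w (bas i))).
Proof.
rewrite -[in LHS](tlift_tensK w) !(lin_tlift_pull _ _ (@lin_lfun _ _ _ q)).
rewrite linear_sum /=.
transitivity (tlift (fun x v => \sum_i q (tens (tens (dual_basis i : Defs.dual H)
   (1 : H) : Defs.double H) (rho (ev x (bas i)) v))) w).
  apply: eq_tlift => x v; rewrite {1}(evK x) (lin_sum (@lin_tensl _ _ _ v)).
  rewrite linear_sum; apply: eq_bigr => i _.
  exact: quotv_proj_tens.
rewrite tlift_bigsum; apply: eq_bigr => i _.
rewrite /ind_eval (lin_tlift_pull _ _ (@lin_tensr _ _ _ _)).
by rewrite (lin_tlift_pull _ _ (@lin_lfun _ _ _ q)).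
Qed.

(** [X] and [f] resolve the identity of the induced module by [quotv_projE]; [ind_eval] vanishes on
    the relations, so the chosen section does not matter. *)
Lemma induced_characterE x :
  induced_character rho x =
  \sum_i \sum_j crd j (ind_act x (fun g => (crd i g : K) *: bas j) (bas i)).
Proof.
rewrite /induced_character lftraceE.
pose X (p : 'I_(\dim {:H}) * 'I_(\dim {:V})) : induced rho :=
  q (tens (tens (dual_basis p.1 : Defs.dual H) (1 : H) : Defs.double H) (bas p.2)).
pose f (p : 'I_(\dim {:H}) * 'I_(\dim {:V})) (z : induced rho) : K^o :=
  crd p.2 (ind_eval (s z) (bas p.1)).
have fl p : lin (f p).
  move=> k a b; rewrite /f linearP (lin_ind_eval _) (@lin_crd _ _ _).
  by [].
have fX z : z = \sum_p (f p z : K) *: X p.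
  rewrite -[LHS]quotv_sectK quotv_projE linear_sum /=.
  rewrite -(pair_bigA _ (fun i j => (f (i, j) z : K) *: X (i, j))) /=.
  apply: eq_bigr => i _; rewrite (basE (ind_eval _ _)).
  rewrite (lin_sum (@lin_tensr _ _ _ _)) linear_sum /=; apply: eq_bigr => j _.
  by rewrite (linZ (@lin_tensr _ _ _ _)) linearZ.
rewrite (ltr_resolution fl fX (@lin_lfun _ _ _ _)).
rewrite -(pair_bigA _ (fun i j => f (i, j) (induced_act rho x (X (i, j))))) /=.
apply: eq_bigr => i _; apply: eq_bigr => j _.
rewrite /f /= /induced_act 2!comp_lfunE ind_eval_sect ind_eval_lmul.
congr (crd j _); apply: eq_ind_act => g.
rewrite /X ind_eval_sect ind_eval_tens ev_tens dual_basisE (linZ (@lin_lfun _ _ _ rho)) scale_lfunE.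
by rewrite (module_act1 hrho) id_lfunE.
Qed.

End Induced.

(** * Sweedler powers and the antipode *)

Section SweedlerPower.
Variables (K : fieldType) (H : hopfAlgType K).
Implicit Types (h : H).
Local Notation S := (antipode : 'End(H)).

Lemma lin_sweedler_pow m : lin (@sweedler_pow K H m).
Proof. by case: m => [|m] /=. Qed.
Local Hint Resolve lin_sweedler_pow : linearity.

Lemma sweedler_powSr m h :
  sweedler_pow m.+1 h = \sw_(a, b <- h) (sweedler_pow m a * b).
Proof.
elim: m h => [|m IH] h.
  transitivity h => /=.
    rewrite -[RHS]counitr; apply: eq_tlift => a b.
    by rewrite -scalerAr mulr1.
  by rewrite -[LHS]counitl; apply: eq_tlift => a b; rewrite -scalerAl mul1r.
rewrite -[LHS]/(\sw_(a, b <- h) (a * sweedler_pow m.+1 b)).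
under eq_tlift => a b do rewrite IH (lin_tlift_pull _ _ (@lin_mull _ _ a)).
rewrite swA //; apply: eq_tlift => a b /=.
rewrite (lin_tlift_pull _ _ (@lin_mulr _ _ b)); apply: eq_tlift => c d.
by rewrite mulrA.
Qed.

(** S reverses both the product and the coproduct, and the two reversals cancel. *)
Lemma antipode_sweedler_pow m h : S (sweedler_pow m h) = sweedler_pow m (S h).
Proof.
elim: m h => [|m IH] h.
  by rewrite /= (linZ (@lin_lfun _ _ _ S)) antipode1 counit_antipode.
rewrite [in RHS]sweedler_powSr sw_antipode //=.
rewrite (lin_tlift_pull _ _ (@lin_lfun _ _ _ S)); apply: eq_tlift => a b.
by rewrite antipodeM IH.
Qed.
End SweedlerPower.

(** * Powers of the Drinfel'd element and the trace formula *)

Section DrinfeldElement.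
Variables (K : fieldType) (H : hopfAlgType K) (L : H).
Hypothesis hL : is_normalized_integral L.
Implicit Types (h g : H) (phi psi : Defs.dual H) (x y : Defs.double H).

Local Notation S := (antipode : 'End(H)).
Local Notation eps := (counit : 'Hom(H, K^o)).
Local Notation T := (antipodeV H).
Local Notation u := (drinfeld_element H).
Local Hint Resolve lin_ev lin_evr lin_dual_eval lin_sweedler_pow : linearity.

Lemma dual_antipodeVE phi : dual_antipodeV H phi = (phi \o T)%VF.
Proof.
have k0 : lker (dual_antipode H) == 0%VS.
  rewrite -subv0; apply/subvP => psi; rewrite memv_ker memv0 dual_antipodeE.
  move=> /eqP/lfunP e; apply/eqP/lfunP => h.
  by have := e (T h); rewrite comp_lfunE (antipodeVK hL) !zero_lfunE.
rewrite -[RHS](lker0_lfunK k0) dual_antipodeE; congr (dual_antipodeV H _).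
by apply/lfunP => h; rewrite !comp_lfunE (antipodeK hL).
Qed.

(** The sum of dual basis tensors corresponds to the identity of H; the antipode on the dual side
    turns it into S^-1. *)
Lemma ev_drinfeld g : ev u g = T g.
Proof.
rewrite /drinfeld_element (lin_sum (lin_ev g)) [RHS]basE; apply: eq_bigr => i _.
by rewrite ev_tens dual_antipodeVE comp_lfunE dual_basisE.
Qed.

Lemma ev_double_one g : ev (double_one H) g = (eps g : K) *: 1.
Proof. exact: ev_tens. Qed.

Hypothesis antipodeK2 : forall h, S (S h) = h.

Lemma antipodeV_id h : T h = S h.
Proof. by rewrite -{1}(antipodeK2 h) (antipodeK hL). Qed.

Lemma sw_antipode_op (W : vectType K) (f : H -> W) h : lin f ->
  \sw_(a, b <- h) f (b * S a) = (eps h : K) *: f 1.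
Proof.
move=> fl; rewrite -antipode1 -(@sw_antipoder _ _ _ (fun z => f (S z))) //.
by apply: eq_tlift => a b; rewrite antipodeM antipodeK2.
Qed.

Lemma ev_drinfeld_mul y g :
  ev (double_mul u y) g = \sw_(g1, g2 <- g) (S g2 * ev y g1).
Proof.
rewrite ev_mul.
transitivity (\sw_(p, q <- g) \sw_(a, b <- p) \sw_(c, d <- a)
  (S d * ev y (c * (q * S b)))).
  apply: eq_tlift => p q; rewrite ev_drinfeld antipodeV_id sw_antipode //.
  apply: eq_tlift => a b; rewrite sw_antipode //; apply: eq_tlift => c d.
  by rewrite antipodeV_id antipodeK2.
rewrite -swA //.
transitivity (\sw_(a, r <- g) ((eps r : K) *: \sw_(c, d <- a) (S d * ev y c))).
  apply: eq_tlift => a r.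
  rewrite (@sw_antipode_op _ (fun z => \sw_(c, d <- a) (S d * ev y (c * z)))) //.
  by congr (_ *: _); apply: eq_tlift => c d; rewrite mulr1.
by rewrite (@sw_counitr _ _ _ (fun a => \sw_(c, d <- a) (S d * ev y c))).
Qed.

Variables (V : vectType K) (rho : 'Hom(H, 'End(V))).
Hypothesis hrho : is_module rho.

(** [C] collects all legs of g and of ev y. The last two legs of g meet in its fourth slot as r_(2)
    S(r_(1)) and cancel by [sw_antipode_op]. *)
Lemma ind_act_drinfeld y (F : H -> V) g : lin F ->
  ind_act rho (double_mul u y) F g =
  \sw_(g1, g2 <- g) rho (S g2) (ind_act rho y F g1).
Proof.
move=> Fl.
pose C p q1 q2 r := \sw_(z1, z' <- ev y p) \sw_(z2, z3 <- z')
  rho (S q2) (rho z2 (F (S z3 * (q1 * (r * z1))))).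
have C1 q1 q2 r : lin (fun p => C p q1 q2 r) by rewrite /C.
have C2 p q2 r : lin (fun q1 => C p q1 q2 r) by rewrite /C.
have C3 p q1 r : lin (fun q2 => C p q1 q2 r) by rewrite /C.
have C4 p q1 q2 : lin (fun r => C p q1 q2 r) by rewrite /C.
transitivity (\sw_(g1, g2 <- g) \sw_(p, q <- g1) \sw_(q1, q' <- q)
  \sw_(q2, q3 <- q') C p q1 q2 (g2 * S q3)).
  rewrite /ind_act; apply: eq_tlift => g1 g2.
  rewrite ev_drinfeld_mul.
  pose R z := \sw_(h1, h' <- z) \sw_(h2, h3 <- h') rho h2 (F (T h3 * (g2 * h1))).
  have Rl : lin R by rewrite /R.
  rewrite -/(R _) (lin_tlift_pull _ _ Rl); apply: eq_tlift => p q.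
  rewrite /R swM // sw_antipode //.
  transitivity (\sw_(q1, q' <- q) \sw_(q2, q3 <- q') \sw_(z1, z' <- ev y p)
    \sw_(z2, z3 <- z') rho (S q2 * z2) (F (S (S q1 * z3) * (g2 * (S q3 * z1)))));
    last first.
    apply: eq_tlift => q1 q'; apply: eq_tlift => q2 q3; rewrite /C.
    apply: eq_tlift => z1 z'; apply: eq_tlift => z2 z3.
    by rewrite (module_actM hrho) comp_lfunE antipodeM antipodeK2 !mulrA.
  rewrite swA //; apply: eq_tlift => a b.
  rewrite exchange_tlift; apply: eq_tlift => z1 z'.
  rewrite swM // sw_antipode //; apply: eq_tlift => c d; apply: eq_tlift => e f.
  by rewrite antipodeV_id.
transitivity (\sw_(p, g' <- g) \sw_(q1, q2 <- g') C p q1 q2 1).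
  rewrite -swA //; apply: eq_tlift => p g'.
  rewrite -swA //; apply: eq_tlift => q1 g''.
  rewrite -swA //.
  transitivity (\sw_(q2, r <- g'') ((eps r : K) *: C p q1 q2 1)).
    by apply: eq_tlift => q2 r; rewrite (@sw_antipode_op _ (C p q1 q2)).
  by rewrite (@sw_counitr _ _ _ (fun q2 => C p q1 q2 1)).
rewrite swA //; apply: eq_tlift => g1 q2.
rewrite /ind_act (lin_tlift_pull _ _ (@lin_lfun _ _ _ (rho (S q2)))).
apply: eq_tlift => p q1.
rewrite (lin_tlift_pull _ _ (@lin_lfun _ _ _ (rho (S q2)))) /C.
apply: eq_tlift => z1 z'.
rewrite (lin_tlift_pull _ _ (@lin_lfun _ _ _ (rho (S q2)))).
by apply: eq_tlift => z2 z3; rewrite mul1r antipodeV_id.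
Qed.

Lemma ind_act_drinfeld_pow m (F : H -> V) g : lin F ->
  ind_act rho (double_pow u m) F g =
  \sw_(a, b <- g) rho (S (sweedler_pow m b)) (F a).
Proof.
move=> Fl; elim: m g => [|m IH] g.
  transitivity (F g).
    rewrite -(@sw_counitl _ _ _ F g Fl); apply: eq_tlift => g1 g2.
    pose R z := \sw_(h1, h' <- z) \sw_(h2, h3 <- h') rho h2 (F (T h3 * (g2 * h1))).
    have Rl : lin R by rewrite /R.
    rewrite ev_double_one -/(R _) (linZ Rl) /R !sw1 // antipodeV_id antipode1.
    by rewrite mul1r mulr1 (module_act1 hrho) id_lfunE.
  rewrite -(@sw_counitr _ _ _ F g Fl); apply: eq_tlift => g1 g2 /=.
  rewrite (linZ (@lin_lfun _ _ _ S)) antipode1 (linZ (@lin_lfun _ _ _ rho)).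
  by rewrite scale_lfunE (module_act1 hrho) id_lfunE.
rewrite [double_pow _ _]iterS ind_act_drinfeld //.
under eq_tlift => g1 g2 do rewrite IH (lin_tlift_pull _ _ (@lin_lfun _ _ _ _)).
rewrite -swA //; apply: eq_tlift => a b.
rewrite [sweedler_pow _ _]sweedler_powSr (lin_tlift_pull _ _ (@lin_lfun _ _ _ S)).
have lrho : lin (fun h => rho h (F a)) by [].
rewrite (lin_tlift_pull _ _ lrho); apply: eq_tlift => c d.
by rewrite antipodeM (module_actM hrho) comp_lfunE.
Qed.

(** For a fixed basis vector of H, summing over the basis of V produces the character, and a trace
    over H alone remains. *)
Lemma induced_character_drinfeld_pow m :
  induced_character rho (double_pow u m) =
  ltr (fun z => \sw_(a, b <- z)
    ((character rho (S (sweedler_pow m b)) : K) *: a)).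
Proof.
rewrite (induced_characterE hL hrho) /ltr; apply: eq_bigr => i _.
rewrite (lin_tlift_pull _ _ (@lin_crd _ _ i)).
transitivity (\sw_(a, b <- bas i) (\sum_j (crd j
   (rho (S (sweedler_pow m b)) ((crd i a : K) *: bas j))) : K^o)).
  rewrite tlift_bigsum; apply: eq_bigr => j _.
  rewrite ind_act_drinfeld_pow; last by move=> k a b; rewrite lin_crd scalerDl scalerA.
  by rewrite (lin_tlift_pull _ _ (@lin_crd _ _ j)).
apply: (@eq_tlift K H H K^o) => a b; rewrite (linZ (@lin_crd _ _ i)) /character lftraceE /ltr.
rewrite scaler_suml; apply: eq_bigr => j _.
by rewrite linearZ (linZ (@lin_crd _ _ j)); exact: mulrC.
Qed.

End DrinfeldElement.

Theorem corollary6p4 (K : closedFieldType) (charK : [pchar K] =i pred0)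
    (H : hopfAlgType K) (ssH : semisimple H)
    (Lambda : H) (hLambda : is_normalized_integral Lambda)
    (V : vectType K) (rho : 'Hom(H, 'End(V))) (hrho : is_module rho)
    (m : nat) :
  fs_indicator Lambda m (character rho) =
  (\dim {:H})%:R^-1 * induced_character rho (double_pow (drinfeld_element H) m).
Proof.
rewrite (induced_character_drinfeld_pow hLambda) //; last first.
  exact: (antipode_sqr charK ssH hLambda).
have chil : lin (fun h : H => character rho ((antipode : 'End(H)) (sweedler_pow m h)) : K^o).
  move=> k g h; rewrite /character !lftraceE /ltr scaler_sumr -big_split.
  apply: eq_bigr => j _; rewrite (lin_sweedler_pow m) !(@lin_lfun _ _ _ _).
  by rewrite add_lfunE scale_lfunE lin_crd.
rewrite (ltr_coaction charK ssH hLambda chil).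
(* S(Lambda^[m]) = S(Lambda)^[m] = Lambda^[m], and dim(H) cancels because it is nonzero in K. *)
rewrite antipode_sweedler_pow (antipode_integral hLambda) mulKf //.
rewrite (natr_inj0 charK) dimv_eq0; apply/negP => /eqP e.
by have := memvf (1 : H); rewrite e memv0 oner_eq0.
Qed.
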